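(* Let $f(z)=z+\sum_{n=2}^{\infty}a_nz^n$ belong to $\mathcal{S}^*_{\xi}$. Then the second Hankel determinant $H_{2,2}(f)=a_2a_4-a_3^2$ satisfies $|H_{2,2}(f)|\le \frac14$. The estimate is sharp: equality holds for some function in $\mathcal{S}^*_{\xi}$.
   Context: $\mathbb{D}=\{z\in\mathbb{C}:|z|<1\}$. $\mathcal{A}$ is the class of analytic functions $f$ on $\mathbb{D}$ of the form $f(z)=z+\sum_{n\ge2}a_nz^n$. For analytic $f,g$ on $\mathbb{D}$, $f\prec g$ means there is an analytic $w:\mathbb{D}\to\mathbb{D}$ with $w(0)=0$ and $f=g\circ w$. Let $\xi(z)=1+\frac{\sin z}{1-z}$ for $z\in\mathbb{D}$, and $\mathcal{S}^*_{\xi}=\{f\in\mathcal{A}: \frac{zf'(z)}{f(z)}\prec \xi(z)\}$. *)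

(* Defs.v *)
From Stdlib Require Import Reals.
From Coquelicot Require Import Coquelicot.
Open Scope C_scope.

Definition Cexp (z : C) : C :=
  (RtoC (exp (Re z)) * (RtoC (cos (Im z)) + Ci * RtoC (sin (Im z))))%C.
Definition Csin (z : C) : C :=
  (Cexp (Ci * z) - Cexp (- (Ci * z))) / (2 * Ci).

Definition xi (z : C) : C := 1 + Csin z / (1 - z).

Definition inD (z : C) : Prop := (Cmod z < 1)%R.

Definition holo_D (w : C -> C) : Prop :=
  forall z, inD z -> exists d : C, @is_derive C_AbsRing C_NormedModule w z d.

Definition in_A (f : C -> C) (a : nat -> C) : Prop :=
  a 0%nat = 0 /\ a 1%nat = 1 /\
  forall z, inD z -> @is_pseries C_AbsRing C_NormedModule a z (f z).

(* f in S*_xi : z f'(z)/f(z) ≺ xi(z), i.e. z f'(z)/f(z) = xi(w(z)) for a Schwarz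
   function w (analytic on D, w(0)=0, |w|<1).  The quotient z f'/f is required
   to be well defined (f(z) <> 0) at z <> 0; at z = 0 it is its removable value. *)
Definition in_S_xi (f : C -> C) (a : nat -> C) : Prop :=
  in_A f a /\
  exists w : C -> C, holo_D w /\ w 0 = 0 /\ (forall z, inD z -> inD (w z)) /\
    forall z, inD z -> z <> 0 ->
      f z <> 0 /\
      exists d : C, @is_derive C_AbsRing C_NormedModule f z d /\
        z * d / f z = xi (w z).

Definition H22 (a : nat -> C) : C := a 2%nat * a 4%nat - a 3%nat * a 3%nat.

(* Main.v *)
(** If [z f'/f = xi(w)] with [w] a Schwarz function, then [xi' <> 0] on the disk lets
    one solve for [w'] in terms of [f], [f'], [f''] and [w], so [w] is twice complex
    differentiable.  That is enough for a maximum principle (no Cauchy theory: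
    [|g|^2 + eps |z|^2] has no interior maximum), hence for two steps of the Schur
    algorithm, which bound the coefficients [c1, c2, c3] of [w].  As
    [H = c1 c3/3 + c1^2 c2/6 - c1^4/18 - c2^2/4], the bound [1/4] is then a real
    inequality in [|c1|], [|c2|].  Equality holds for [w = z^2]; there [f = z G(z^2)]
    with [2 u G' = (xi(u) - 1) G], solved by a power series with bounded coefficients. *)

Require Import Defs.
From Stdlib Require Import Reals Factorial Lra Lia Psatz Classical ClassicalEpsilon.
From Coquelicot Require Import Coquelicot.
Local Open Scope C_scope.

(** * Complex differentiability *)

(** Only one complex derivative of [w] is given, and no expansion of [w] at 0; both gaps are filled
    from [f], whose power series may be differentiated termwise. With [F = f/z] the hypothesis reads
    [(1 - w)(f' - F) = F sin w], that is, [w f' = f' - F + F w^3/6 + O(z^4)]. Reading off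
    coefficients gives [c1 = a2], [c2 = 2 a3 - 2 a2^2], [c3 = 3 a4 + c1^3/6 - 2 c1 c2 - 3 a3 c1],
    and substituting turns [a2 a4 - a3^2] into a polynomial in [c1, c2, c3]. Coefficients of [w]
    therefore mean asymptotics at 0, and the quotients [w/z] and their Schur transforms live on the
    punctured disk, where they need no value at 0. The Schur step degenerates when [|c1| = 1]; that
    case is reached by scaling [w/z] with [s < 1] and letting [s] tend to 1. The final real
    inequality is tight only at [c1 = 0], [|c2| = 1], which is where the extremal [w] comes from. *)

Lemma Cmod_le_re_im (z : C) : (Cmod z <= Rabs (Re z) + Rabs (Im z))%R.
Proof.
destruct z as [x y]; unfold Cmod; simpl.
apply Rsqr_incr_0_var; [|pose proof (Rabs_pos x); pose proof (Rabs_pos y); lra].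
rewrite Rsqr_sqrt by nra.
unfold Rsqr.
assert (Rabs x * Rabs x = x * x)%R by (rewrite <- Rabs_mult; apply Rabs_pos_eq; nra).
assert (Rabs y * Rabs y = y * y)%R by (rewrite <- Rabs_mult; apply Rabs_pos_eq; nra).
pose proof (Rabs_pos x); pose proof (Rabs_pos y); nra.
Qed.

Lemma im_le_Cmod (z : C) : (Rabs (Im z) <= Cmod z)%R.
Proof. eapply Rle_trans; [|apply Rmax_Cmod]. apply Rmax_r. Qed.

Lemma Cmod_minus_sym (x y : C) : Cmod (x - y) = Cmod (y - x).
Proof. rewrite <- Cmod_opp. f_equal. ring. Qed.

Lemma Cmod_triangle_inv (x y : C) : (Cmod x - Cmod y <= Cmod (x - y))%R.
Proof.
pose proof (Cmod_triangle (x - y) y) as H.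
replace (x - y + y) with x in H by ring. lra.
Qed.

Lemma Cmod_triangle_minus (x y : C) : (Cmod (x - y) <= Cmod x + Cmod y)%R.
Proof. unfold Cminus. rewrite <- (Cmod_opp y). apply Cmod_triangle. Qed.

Lemma Cminus_eq_0 (x y : C) : x - y = 0 -> x = y.
Proof. intros H. replace x with (x - y + y) by ring. rewrite H. ring. Qed.

(** * Pointwise continuity of complex functions *)

Definition ccont (f : C -> C) (z : C) : Prop :=
  forall eps : R, (0 < eps)%R -> exists del : R, (0 < del)%R /\
    forall z', (Cmod (z' - z) < del)%R -> (Cmod (f z' - f z) < eps)%R.

Lemma ccont_const (c z : C) : ccont (fun _ => c) z.
Proof.
intros e He. exists 1%R. split; [lra|]. intros z' _.
replace (c - c) with (RtoC 0) by ring. now rewrite Cmod_0.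
Qed.

Lemma ccont_id (z : C) : ccont (fun x => x) z.
Proof. intros e He. exists e. auto. Qed.

Lemma ccont_bound (f : C -> C) (z : C) : ccont f z ->
  exists del : R, (0 < del)%R /\
    forall z', (Cmod (z' - z) < del)%R -> (Cmod (f z') <= Cmod (f z) + 1)%R.
Proof.
intros H. destruct (H 1%R ltac:(lra)) as (d & Hd & Hf).
exists d; split; auto. intros z' Hz'. specialize (Hf z' Hz').
pose proof (Cmod_triangle_inv (f z') (f z)). lra.
Qed.

Lemma ccont_plus (f g : C -> C) (z : C) :
  ccont f z -> ccont g z -> ccont (fun x => f x + g x) z.
Proof.
intros Hf Hg e He.
destruct (Hf (e/2)%R ltac:(lra)) as (d1 & Hd1 & H1).
destruct (Hg (e/2)%R ltac:(lra)) as (d2 & Hd2 & H2).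
exists (Rmin d1 d2). split; [now apply Rmin_pos|]. intros z' Hz'.
specialize (H1 z' (Rlt_le_trans _ _ _ Hz' (Rmin_l _ _))).
specialize (H2 z' (Rlt_le_trans _ _ _ Hz' (Rmin_r _ _))).
replace (f z' + g z' - (f z + g z)) with ((f z' - f z) + (g z' - g z)) by ring.
eapply Rle_lt_trans; [apply Cmod_triangle|lra].
Qed.

Lemma ccont_mult (f g : C -> C) (z : C) :
  ccont f z -> ccont g z -> ccont (fun x => f x * g x) z.
Proof.
intros Hf Hg e He.
destruct (ccont_bound g z Hg) as (d0 & Hd0 & H0).
pose proof (Cmod_ge_0 (g z)) as Pg. pose proof (Cmod_ge_0 (f z)) as Pf.
set (A := (Cmod (g z) + 1)%R) in *. set (B := (Cmod (f z) + 1)%R).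
assert (HA : (0 < A)%R) by (unfold A; lra). assert (HB : (0 < B)%R) by (unfold B; lra).
destruct (Hf (e/2/A)%R) as (d1 & Hd1 & H1). { apply Rdiv_lt_0_compat; lra. }
destruct (Hg (e/2/B)%R) as (d2 & Hd2 & H2). { apply Rdiv_lt_0_compat; lra. }
exists (Rmin d0 (Rmin d1 d2)). split; [now repeat apply Rmin_pos|]. intros z' Hz'.
assert (Hz0 := Rlt_le_trans _ _ _ Hz' (Rmin_l _ _)).
assert (Hz1 := Rlt_le_trans _ _ _ (Rlt_le_trans _ _ _ Hz' (Rmin_r _ _)) (Rmin_l _ _)).
assert (Hz2 := Rlt_le_trans _ _ _ (Rlt_le_trans _ _ _ Hz' (Rmin_r _ _)) (Rmin_r _ _)).
specialize (H0 z' Hz0). specialize (H1 z' Hz1). specialize (H2 z' Hz2).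
replace (f z' * g z' - f z * g z) with ((f z' - f z) * g z' + f z * (g z' - g z)) by ring.
eapply Rle_lt_trans; [apply Cmod_triangle|]. rewrite !Cmod_mult.
pose proof (Cmod_ge_0 (f z' - f z)). pose proof (Cmod_ge_0 (g z' - g z)).
assert (X1 : (Cmod (f z' - f z) * A < e/2)%R).
{ apply Rmult_lt_reg_r with (/A)%R; [now apply Rinv_0_lt_compat|].
  rewrite Rmult_assoc, Rinv_r, Rmult_1_r by lra. exact H1. }
assert (X2 : (B * Cmod (g z' - g z) < e/2)%R).
{ apply Rmult_lt_reg_r with (/B)%R; [now apply Rinv_0_lt_compat|].
  replace (B * Cmod (g z' - g z) * / B)%R with (Cmod (g z' - g z)) by (field; lra).
  exact H2. }
unfold B in X2. nra.
Qed.

Lemma ccont_comp (f g : C -> C) (z : C) :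
  ccont f (g z) -> ccont g z -> ccont (fun x => f (g x)) z.
Proof.
intros Hf Hg e He. destruct (Hf e He) as (d & Hd & H).
destruct (Hg d Hd) as (d' & Hd' & H'). exists d'. auto.
Qed.

Lemma ccont_ne_0 (f : C -> C) (z : C) : ccont f z -> f z <> 0 ->
  exists del : R, (0 < del)%R /\
    forall z', (Cmod (z' - z) < del)%R -> (Cmod (f z) / 2 < Cmod (f z'))%R.
Proof.
intros Hf H0. assert (P : (0 < Cmod (f z))%R) by now apply Cmod_gt_0.
destruct (Hf (Cmod (f z) / 2)%R ltac:(lra)) as (d & Hd & H).
exists d; split; auto. intros z' Hz'. specialize (H z' Hz').
rewrite Cmod_minus_sym in H. pose proof (Cmod_triangle_inv (f z) (f z')). lra.
Qed.

Lemma ccont_inv (f : C -> C) (z : C) :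
  ccont f z -> f z <> 0 -> ccont (fun x => / f x) z.
Proof.
intros Hf H0 e He. assert (P : (0 < Cmod (f z))%R) by now apply Cmod_gt_0.
destruct (ccont_ne_0 f z Hf H0) as (d & Hd & H).
destruct (Hf (e * (Cmod (f z) * (Cmod (f z) / 2)))%R) as (d' & Hd' & H').
{ apply Rmult_lt_0_compat; nra. }
exists (Rmin d d'). split; [now apply Rmin_pos|]. intros z' Hz'.
specialize (H z' (Rlt_le_trans _ _ _ Hz' (Rmin_l _ _))).
specialize (H' z' (Rlt_le_trans _ _ _ Hz' (Rmin_r _ _))).
assert (N : f z' <> 0) by (apply Cmod_gt_0; lra).
replace (/ f z' - / f z) with ((f z - f z') / (f z' * f z)) by (field; auto).
rewrite Cmod_div by (apply Cmult_neq_0; auto). rewrite Cmod_mult, Cmod_minus_sym.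
assert (0 < Cmod (f z') * Cmod (f z))%R by nra.
apply Rmult_lt_reg_r with (Cmod (f z') * Cmod (f z))%R; auto.
unfold Rdiv. rewrite Rmult_assoc, Rinv_l, Rmult_1_r by lra.
eapply Rlt_le_trans; [exact H'|]. apply Rmult_le_compat_l; nra.
Qed.

(** Carathéodory's form of complex differentiability: the difference quotient
    [phi] is continuous, which makes the product and chain rules algebraic. *)
Definition cderiv (f : C -> C) (z d : C) : Prop :=
  exists phi : C -> C, ccont phi z /\ phi z = d /\
    forall z', f z' = f z + phi z' * (z' - z).

Definition cdiff (f : C -> C) (z : C) : Prop := exists d, cderiv f z d.

(** The working form for estimates and the bridge to [is_derive]; Carathéodory's form serves for
    algebra. *)
Lemma cderiv_eps (f : C -> C) (z d : C) :
  cderiv f z d <->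
  forall eps : R, (0 < eps)%R -> exists del : R, (0 < del)%R /\
    forall z', (Cmod (z' - z) < del)%R ->
      (Cmod (f z' - f z - d * (z' - z)) <= eps * Cmod (z' - z))%R.
Proof.
split.
- intros (phi & Hc & Hd & H) e He.
  destruct (Hc e He) as (del & Hdel & Hz). exists del; split; auto. intros z' Hz'.
  rewrite (H z'). replace (f z + phi z' * (z' - z) - f z - d * (z' - z))
    with ((phi z' - phi z) * (z' - z)) by (rewrite Hd; ring).
  rewrite Cmod_mult. apply Rmult_le_compat_r; [apply Cmod_ge_0|]. left; auto.
- intros H.
  exists (fun z' => if excluded_middle_informative (z' = z) then d
                    else (f z' - f z) / (z' - z)).
  repeat split.
  + intros e He. destruct (H (e/2)%R ltac:(lra)) as (del & Hdel & Hz).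
    exists del; split; auto. intros z' Hz'.
    destruct (excluded_middle_informative (z = z)) as [_|N]; [|now elim N].
    destruct (excluded_middle_informative (z' = z)) as [E|N].
    { replace (d - d) with (RtoC 0) by ring. now rewrite Cmod_0. }
    assert (N' : z' - z <> 0) by (intros E; apply N; now apply Cminus_eq_0).
    assert (P := proj1 (Cmod_gt_0 _) N').
    replace ((f z' - f z) / (z' - z) - d) with
      ((f z' - f z - d * (z' - z)) / (z' - z)) by (field; auto).
    rewrite Cmod_div by auto. specialize (Hz z' Hz').
    apply Rmult_lt_reg_r with (Cmod (z' - z)); auto.
    unfold Rdiv. rewrite Rmult_assoc, Rinv_l, Rmult_1_r by lra. nra.
  + destruct (excluded_middle_informative (z = z)) as [_|N]; [auto|now elim N].
  + intros z'. destruct (excluded_middle_informative (z' = z)) as [E|N].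
    * subst z'. ring.
    * field. intros E; apply N; now apply Cminus_eq_0.
Qed.

Lemma cderiv_is_derive (f : C -> C) (z d : C) :
  cderiv f z d <-> @is_derive C_AbsRing C_NormedModule f z d.
Proof.
rewrite cderiv_eps. split.
- intros H. split; [apply is_linear_scal_l|].
  intros x Hx. apply (@is_filter_lim_locally_unique C_AbsRing (AbsRing_NormedModule C_AbsRing)) in Hx.
  rewrite <- Hx in *. clear x Hx.
  intros eps. destruct (H eps (cond_pos eps)) as (del & Hdel & Hz).
  exists (mkposreal del Hdel). intros y Hy. specialize (Hz y Hy).
  change (Cmod (f y - f z - (y - z) * d) <= eps * Cmod (y - z))%R.
  replace ((y - z) * d) with (d * (y - z)) by ring. exact Hz.
- intros [_ H] e He. specialize (H z (fun P HP => HP) (mkposreal e He)).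
  destruct H as [del H]. exists del; split; [apply cond_pos|].
  intros z' Hz'. specialize (H z' Hz').
  change (Cmod (f z' - f z - (z' - z) * d) <= e * Cmod (z' - z))%R in H.
  replace (d * (z' - z)) with ((z' - z) * d) by ring. exact H.
Qed.

Lemma cderiv_ccont (f : C -> C) (z d : C) : cderiv f z d -> ccont f z.
Proof.
intros (phi & Hc & Hd & H).
assert (ccont (fun z' => f z + phi z' * (z' + - z)) z) as G.
{ apply ccont_plus; [apply ccont_const|]. apply ccont_mult; auto.
  apply ccont_plus; [apply ccont_id|apply ccont_const]. }
intros e He. destruct (G e He) as (del & Hdel & Hz). exists del; split; auto.
intros z' Hz'. specialize (Hz z' Hz'). rewrite (H z').
replace (f z + phi z' * (z' - z) - f z) with
  (f z + phi z' * (z' + - z) - (f z + phi z * (z + - z))) by ring. exact Hz.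
Qed.

(** Used to equate two computations of one derivative: this is how [w'] is solved for, and how a
    derivative known to exist is identified with the termwise one. *)
Lemma cderiv_unique (f : C -> C) (z d1 d2 : C) :
  cderiv f z d1 -> cderiv f z d2 -> d1 = d2.
Proof.
rewrite !cderiv_eps. intros H1 H2. apply Cminus_eq_0, Cmod_eq_0.
apply Rle_antisym; [|apply Cmod_ge_0]. apply le_epsilon. intros e He. rewrite Rplus_0_l.
destruct (H1 (e/2)%R ltac:(lra)) as (a & Ha & Hz1).
destruct (H2 (e/2)%R ltac:(lra)) as (b & Hb & Hz2).
set (m := Rmin a b). assert (Hm : (0 < m)%R) by now apply Rmin_pos.
set (h := RtoC (m/2)%R).
assert (Hh : Cmod h = (m/2)%R) by (unfold h; rewrite Cmod_R, Rabs_pos_eq; lra).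
assert (E : z + h - z = h) by ring.
specialize (Hz1 (z + h)). specialize (Hz2 (z + h)). rewrite E, Hh in *.
pose proof (Rmin_l a b : m <= a)%R. pose proof (Rmin_r a b : m <= b)%R.
specialize (Hz1 ltac:(lra)). specialize (Hz2 ltac:(lra)).
assert (K : (Cmod ((d1 - d2) * h) <= e * (m/2))%R).
{ replace ((d1 - d2) * h) with
   ((f (z + h) - f z - d2 * h) - (f (z + h) - f z - d1 * h)) by ring.
  eapply Rle_trans; [apply Cmod_triangle_minus|]. lra. }
rewrite Cmod_mult, Hh in K. apply Rmult_le_reg_r with (m/2)%R; lra.
Qed.

Lemma cderiv_ext_loc (f g : C -> C) (z d : C) (r : R) : (0 < r)%R ->
  (forall z', (Cmod (z' - z) < r)%R -> f z' = g z') -> cderiv f z d -> cderiv g z d.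
Proof.
intros Hr He. rewrite !cderiv_eps. intros H e Hpos.
destruct (H e Hpos) as (a & Ha & Hz). exists (Rmin a r).
split; [now apply Rmin_pos|]. intros z' Hz'.
rewrite <- !He; auto.
- apply Hz. eapply Rlt_le_trans; [exact Hz'|apply Rmin_l].
- replace (z - z) with (RtoC 0) by ring. now rewrite Cmod_0.
- eapply Rlt_le_trans; [exact Hz'|apply Rmin_r].
Qed.

Lemma cderiv_val (f : C -> C) (z d d' : C) : cderiv f z d -> d = d' -> cderiv f z d'.
Proof. now intros H <-. Qed.

Lemma cderiv_const (c z : C) : cderiv (fun _ => c) z 0.
Proof. exists (fun _ => 0). split; [apply ccont_const|]. split; auto. intros; ring. Qed.

Lemma cderiv_id (z : C) : cderiv (fun x => x) z 1.
Proof. exists (fun _ => 1). split; [apply ccont_const|]. split; auto. intros; ring. Qed.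

Lemma cderiv_plus (f g : C -> C) (z d e : C) :
  cderiv f z d -> cderiv g z e -> cderiv (fun x => f x + g x) z (d + e).
Proof.
intros (p & Hp & <- & Hf) (q & Hq & <- & Hg).
exists (fun x => p x + q x). split; [now apply ccont_plus|]. split; auto.
intros z'. rewrite (Hf z'), (Hg z'). ring.
Qed.

Lemma cderiv_mult (f g : C -> C) (z d e : C) :
  cderiv f z d -> cderiv g z e -> cderiv (fun x => f x * g x) z (d * g z + f z * e).
Proof.
intros Hf' Hg'. assert (Cg := cderiv_ccont _ _ _ Hg').
destruct Hf' as (p & Hp & <- & Hf). destruct Hg' as (q & Hq & <- & Hg).
exists (fun x => p x * g x + f z * q x). split.
- apply ccont_plus; apply ccont_mult; auto. apply ccont_const.
- split; auto. intros z'. rewrite (Hf z'), (Hg z'). ring.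
Qed.

Lemma cderiv_opp (f : C -> C) (z d : C) : cderiv f z d -> cderiv (fun x => - f x) z (- d).
Proof.
intros (p & Hp & <- & Hf). exists (fun x => (- (1)) * p x). split.
- apply ccont_mult; auto. apply ccont_const.
- split; [ring|]. intros z'. rewrite (Hf z'). ring.
Qed.

Lemma cderiv_minus (f g : C -> C) (z d e : C) :
  cderiv f z d -> cderiv g z e -> cderiv (fun x => f x - g x) z (d - e).
Proof. intros Hf Hg. apply cderiv_plus; auto. now apply cderiv_opp. Qed.

Lemma cderiv_scal (f : C -> C) (c z d : C) : cderiv f z d -> cderiv (fun x => c * f x) z (c * d).
Proof.
intros H. eapply cderiv_val.
- apply cderiv_mult; [apply cderiv_const|exact H].
- cbv beta; ring.
Qed.

Lemma cderiv_comp (f g : C -> C) (z d e : C) :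
  cderiv f (g z) d -> cderiv g z e -> cderiv (fun x => f (g x)) z (d * e).
Proof.
intros (p & Hp & <- & Hf) Hg'. assert (Cg := cderiv_ccont _ _ _ Hg').
destruct Hg' as (q & Hq & <- & Hg).
exists (fun x => p (g x) * q x). split.
- apply ccont_mult; auto. now apply (ccont_comp p g).
- split; auto. intros z'. rewrite (Hf (g z')).
  replace (g z' - g z) with (q z' * (z' - z)) by (rewrite (Hg z'); ring). ring.
Qed.

Lemma cderiv_inv (f : C -> C) (z d : C) :
  cderiv f z d -> f z <> 0 -> cderiv (fun x => / f x) z (- d / (f z * f z)).
Proof.
intros Hf' H0. assert (Cf := cderiv_ccont _ _ _ Hf').
destruct (ccont_ne_0 f z Cf H0) as (r & Hr & Hnz).
destruct Hf' as (p & Hp & <- & Hf).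
assert (Ci : ccont (fun x => / f x) z) by now apply ccont_inv.
rewrite cderiv_eps. intros e He.
(* This slope function is valid only near [z], where [f] does not vanish, whereas Carathéodory's
   form asks for all points; hence the detour through [cderiv_eps]. *)
assert (G : ccont (fun x => (- / f z) * (p x * / f x)) z).
{ apply ccont_mult; [apply ccont_const|]. now apply ccont_mult. }
destruct (G e He) as (a & Ha & Hz). exists (Rmin a r). split; [now apply Rmin_pos|].
intros z' Hz'.
specialize (Hz z' (Rlt_le_trans _ _ _ Hz' (Rmin_l _ _))).
specialize (Hnz z' (Rlt_le_trans _ _ _ Hz' (Rmin_r _ _))).
assert (N : f z' <> 0).
{ apply Cmod_gt_0. pose proof (Cmod_ge_0 (f z)). lra. }
replace (/ f z' - / f z - - p z / (f z * f z) * (z' - z)) with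
  ((- / f z * (p z' * / f z') - - / f z * (p z * / f z)) * (z' - z)).
- rewrite Cmod_mult. apply Rmult_le_compat_r; [apply Cmod_ge_0|]. now left.
- assert (E : / f z' - / f z = - / f z * (p z' * / f z') * (z' - z)).
  { transitivity (- / f z * / f z' * (p z' * (z' - z))); [|ring].
    replace (p z' * (z' - z)) with (f z' - f z) by (rewrite (Hf z'); ring).
    field. auto. }
  rewrite E. field; auto.
Qed.

Lemma cderiv_div (f g : C -> C) (z d e : C) :
  cderiv f z d -> cderiv g z e -> g z <> 0 ->
  cderiv (fun x => f x / g x) z ((d * g z - f z * e) / (g z * g z)).
Proof.
intros Hf Hg N. eapply cderiv_val.
- apply cderiv_mult; [exact Hf|apply cderiv_inv; [exact Hg|exact N]].
- cbv beta; field. auto.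
Qed.

Lemma cderiv_pow (f : C -> C) (n : nat) (z d : C) :
  cderiv f z d -> cderiv (fun x => f x ^ n) z (RtoC (INR n) * f z ^ (pred n) * d).
Proof.
intros H. induction n as [|n IH].
- simpl. eapply cderiv_val; [apply cderiv_const|]. ring.
- change (cderiv (fun x => f x * f x ^ n) z (RtoC (INR (S n)) * f z ^ n * d)).
  eapply cderiv_val; [apply cderiv_mult; [exact H|exact IH]|].
  rewrite S_INR, RtoC_plus. destruct n; [simpl; ring|]. simpl pred. rewrite Cpow_S. ring.
Qed.

(** Mean value theorem for [t |-> Re (conj D * F (z + t h))] with [D = F (z + h) - F z]. *)
Lemma cderiv_bound_pow (F F' : C -> C) (z : C) (r k : R) (n : nat) :
  (forall h, (Cmod h < r)%R -> cderiv F (z + h) (F' h)) ->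
  (forall h, (Cmod h < r)%R -> (Cmod (F' h) <= k * Cmod h ^ n)%R) ->
  forall h, (Cmod h < r)%R ->
  (Cmod (F (z + h)%C - F z) <= k * Cmod h ^ S n / INR (S n))%R.
Proof.
intros HF Hb h Hh.
set (D := F (z + h)%C - F z).
destruct (Req_dec (Cmod D) 0) as [E|E].
{ rewrite E. specialize (Hb h Hh).
  apply Rmult_le_pos; [|left; apply Rinv_0_lt_compat, lt_0_INR; lia].
  simpl. pose proof (Cmod_ge_0 h). pose proof (Cmod_ge_0 (F' h)). nra. }
set (u := Cconj D).
assert (Hu : Cmod u = Cmod D) by apply Cmod_conj.
(* Subtracting a primitive of the bound on the derivative makes [phi] nonincreasing; integrating
   [t^n] is what produces the factor [1 / INR (S n)]. *)
set (phi := fun t : R => (Re (u * F (z + t * h)%C) - Cmod D * (k * Cmod h ^ S n / INR (S n)) * t ^ S n)%R).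
set (phi' := fun t : R => (Re (u * (F' (t * h)%C * h)) - Cmod D * (k * Cmod h ^ S n) * t ^ n)%R).
assert (Hin : forall t : R, (0 <= t <= 1)%R -> (Cmod (t * h) < r)%R).
{ intros t Ht. rewrite Cmod_mult, Cmod_R, Rabs_pos_eq by lra.
  pose proof (Cmod_ge_0 h). nra. }
assert (Hder : forall t : R, (0 <= t <= 1)%R -> derivable_pt_lim phi t (phi' t)).
{ intros t Ht. apply derivable_pt_lim_minus.
  - assert (G : cderiv (fun s => u * F (z + s * h)%C) t (u * (F' (t * h)%C * h))).
    { apply cderiv_scal. apply (cderiv_comp F (fun s => z + s * h)); [now apply HF, Hin|].
      eapply cderiv_val.
      - apply cderiv_plus; [apply cderiv_const|]. apply cderiv_mult; [apply cderiv_id|apply cderiv_const].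
      - cbv beta; ring. }
    rewrite cderiv_eps in G. intros e He.
    destruct (G (e/2)%R ltac:(lra)) as (del & Hdel & Hz).
    exists (mkposreal del Hdel). intros s Hs Hsd. simpl in Hsd.
    specialize (Hz (RtoC (t + s))).
    replace (RtoC (t + s) - t) with (RtoC s) in Hz by (rewrite RtoC_plus; ring).
    rewrite Cmod_R in Hz. specialize (Hz Hsd).
    pose proof (re_le_Cmod (u * F (z + RtoC (t + s) * h)%C - u * F (z + t * h)%C - u * (F' (t * h)%C * h) * s)) as R1.
    assert (E1 : (Re (u * F (z + RtoC (t + s) * h)%C - u * F (z + t * h)%C - u * (F' (t * h)%C * h) * s)
      = Re (u * F (z + RtoC (t + s) * h)%C) - Re (u * F (z + t * h)%C) - Re (u * (F' (t * h)%C * h)) * s)%R).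
    { generalize (u * F (z + RtoC (t + s) * h)%C) (u * F (z + t * h)%C) (u * (F' (t * h)%C * h)).
      intros [a1 a2] [b1 b2] [c1 c2]. simpl. ring. }
    rewrite E1 in R1.
    replace ((Re (u * F (z + RtoC (t + s) * h)%C) - Re (u * F (z + t * h)%C)) / s - Re (u * (F' (t * h)%C * h)))%R
      with ((Re (u * F (z + RtoC (t + s) * h)%C) - Re (u * F (z + t * h)%C) - Re (u * (F' (t * h)%C * h)) * s) / s)%R
      by (field; auto).
    unfold Rdiv. rewrite Rabs_mult, Rabs_inv.
    assert (0 < Rabs s)%R by now apply Rabs_pos_lt.
    apply Rmult_lt_reg_r with (Rabs s); auto.
    rewrite Rmult_assoc, Rinv_l, Rmult_1_r by lra. nra.
  - replace (Cmod D * (k * Cmod h ^ S n) * t ^ n)%R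
      with (Cmod D * (k * Cmod h ^ S n / INR (S n)) * (INR (S n) * t ^ pred (S n)))%R.
    + apply derivable_pt_lim_scal. apply derivable_pt_lim_pow.
    + simpl pred. field. apply not_0_INR. lia. }
destruct (MVT_cor2 phi phi' 0 1 ltac:(lra) Hder) as (t & Ht & Ht01).
assert (Neg : (phi' t <= 0)%R).
{ unfold phi'. assert (Hti : (0 <= t <= 1)%R) by lra.
  specialize (Hb (t * h)%C (Hin t Hti)).
  pose proof (re_le_Cmod (u * (F' (t * h)%C * h))) as R1. rewrite !Cmod_mult, Hu in R1.
  pose proof (Rle_abs (Re (u * (F' (t * h)%C * h)))) as R2.
  rewrite Cmod_mult, Cmod_R, Rabs_pos_eq, Rpow_mult_distr in Hb by lra.
  pose proof (Cmod_ge_0 h). pose proof (Cmod_ge_0 D).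
  assert (Cmod (F' (t * h)%C) * Cmod h <= k * (t ^ n * Cmod h ^ n) * Cmod h)%R
    by (apply Rmult_le_compat_r; lra).
  assert (Cmod D * (Cmod (F' (t * h)%C) * Cmod h) <= Cmod D * (k * (t ^ n * Cmod h ^ n) * Cmod h))%R
    by (apply Rmult_le_compat_l; lra).
  replace (Cmod h ^ S n)%R with (Cmod h * Cmod h ^ n)%R by reflexivity. nra. }
assert (X : (phi 1 - phi 0 <= 0)%R) by (rewrite Ht; lra).
unfold phi in X. rewrite pow1, pow_i in X by lia.
replace (z + RtoC 1 * h) with (z + h) in X by ring.
replace (z + RtoC 0 * h) with z in X by ring.
assert (E2 : (Re (u * F (z + h)%C) - Re (u * F z) = Cmod D ^ 2)%R).
{ transitivity (Re (u * D)).
  - unfold D. generalize u (F (z + h)) (F z). intros [a1 a2] [b1 b2] [c1 c2]. simpl. ring.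
  - unfold u. rewrite Cmod2_alt. destruct D as [a b]. simpl. ring. }
pose proof (Cmod_ge_0 D).
apply Rmult_le_reg_l with (Cmod D); [lra|]. nra.
Qed.

(** * Maximum principle *)

(** The error has derivative [g1 (z + h) - g1 z - g2 * h], of size at most [eps |h|] by
    differentiability of [g1] at [z]; [cderiv_bound_pow] with exponent 1 integrates this to order
    [|h|^2]. *)
Lemma cderiv_taylor2 (g g1 : C -> C) (z g2 : C) (r : R) : (0 < r)%R ->
  (forall h, (Cmod h < r)%R -> cderiv g (z + h) (g1 (z + h))) -> cderiv g1 z g2 ->
  forall eps : R, (0 < eps)%R -> exists del : R, (0 < del)%R /\
    forall h, (Cmod h < del)%R ->
      (Cmod (g (z + h)%C - g z - g1 z * h - g2 * (h * h) / 2) <= eps * Cmod h ^ 2)%R.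
Proof.
intros Hr Hg Hg1 e He.
rewrite cderiv_eps in Hg1. destruct (Hg1 e He) as (a & Ha & Hz).
exists (Rmin a r). split; [now apply Rmin_pos|]. intros h Hh.
pose (F := fun x => g x - g1 z * (x - z) - g2 / 2 * ((x - z) * (x - z))).
assert (B := cderiv_bound_pow F (fun h => g1 (z + h) - g1 z - g2 * h) z (Rmin a r) e 1).
assert (X : (Cmod (F (z + h)%C - F z) <= e * Cmod h ^ 2 / INR 2)%R).
{ apply B; auto.
  - intros k Hk. unfold F.
    assert (L : cderiv (fun x => x - z) (z + k) 1).
    { eapply cderiv_val; [apply cderiv_minus; [apply cderiv_id|apply cderiv_const]|ring]. }
    eapply cderiv_val.
    + apply cderiv_minus; [apply cderiv_minus|].
      * apply Hg. eapply Rlt_le_trans; [exact Hk|apply Rmin_r].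
      * apply cderiv_scal, L.
      * apply cderiv_scal. apply cderiv_mult; exact L.
    + cbv beta. field.
  - intros k Hk. rewrite pow_1.
    replace (g1 (z + k) - g1 z - g2 * k) with (g1 (z + k) - g1 z - g2 * (z + k - z)) by ring.
    replace k with (z + k - z) at 3 by ring. apply Hz.
    replace (z + k - z) with k by ring. eapply Rlt_le_trans; [exact Hk|apply Rmin_l]. }
unfold F in X.
replace (g (z + h) - g z - g1 z * h - g2 * (h * h) / 2) with
 (g (z + h) - g1 z * (z + h - z) - g2 / 2 * ((z + h - z) * (z + h - z)) -
        (g z - g1 z * (z - z) - g2 / 2 * ((z - z) * (z - z)))) by field.
eapply Rle_trans; [exact X|]. simpl INR.
pose proof (pow2_ge_0 (Cmod h)). nra.
Qed.

(** The average over the four points [z + i^j s] sees the Laplacian of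
    [|g|^2 + eps |z|^2], which is at least [4 eps]. *)
Lemma no_local_max (g g1 : C -> C) (z g2 : C) (r eps : R) : (0 < r)%R -> (0 < eps)%R ->
  (forall h, (Cmod h < r)%R -> cderiv g (z + h) (g1 (z + h))) -> cderiv g1 z g2 ->
  exists h, (Cmod h < r)%R /\
    (Cmod (g z) ^ 2 + eps * Cmod z ^ 2 < Cmod (g (z + h)%C) ^ 2 + eps * Cmod (z + h) ^ 2)%R.
Proof.
intros Hr He Hg Hg1. apply NNPP. intros Hno.
assert (Hle : forall h, (Cmod h < r)%R ->
  (Cmod (g (z + h)%C) ^ 2 + eps * Cmod (z + h) ^ 2 <= Cmod (g z) ^ 2 + eps * Cmod z ^ 2)%R).
{ intros h Hh. apply Rnot_lt_le. intros Hl. apply Hno. now exists h. }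
clear Hno.
set (B := (Cmod (g z) + Cmod (g1 z) + Cmod g2)%R).
pose proof (Cmod_ge_0 (g z)). pose proof (Cmod_ge_0 (g1 z)). pose proof (Cmod_ge_0 g2).
assert (HB : (0 <= B)%R) by (unfold B; lra).
(* Replacing [g] by its Taylor polynomial inside [|g|^2] costs at most [2 B eta s^2] at each of the
   four points, so at most [2 eps s^2] in total, against the [4 eps s^2] gained from [eps |z|^2]. *)
destruct (cderiv_taylor2 g g1 z g2 r Hr Hg Hg1 (eps / (4 * (B + 1)))%R) as (del & Hdel & Ht).
{ apply Rdiv_lt_0_compat; lra. }
set (eta := (eps / (4 * (B + 1)))%R) in *.
assert (Heta : (eta * (4 * (B + 1)) = eps)%R) by (unfold eta; field; lra).
assert (Heta0 : (0 < eta)%R) by (apply Rdiv_lt_0_compat; lra).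
set (m := Rmin 1 (Rmin del r)). assert (Hm : (0 < m)%R) by (repeat apply Rmin_pos; lra).
assert (m <= 1)%R by apply Rmin_l.
assert (m <= del)%R by (eapply Rle_trans; [apply Rmin_r|apply Rmin_l]).
assert (m <= r)%R by (eapply Rle_trans; [apply Rmin_r|apply Rmin_r]).
set (s := (m / 2)%R). assert (0 < s)%R by (unfold s; lra). assert (s < m)%R by (unfold s; lra).
assert (K : forall h, Cmod h = s ->
  (Cmod (g z + g1 z * h + g2 * (h * h) / 2) ^ 2 - 2 * B * eta * s ^ 2 + eps * Cmod (z + h) ^ 2
    <= Cmod (g z) ^ 2 + eps * Cmod z ^ 2)%R).
{ intros h Hh. specialize (Hle h ltac:(lra)). specialize (Ht h ltac:(lra)). rewrite Hh in Ht.
  set (A := g z + g1 z * h + g2 * (h * h) / 2) in *.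
  assert (HA : (Cmod A <= B)%R).
  { unfold A, B. eapply Rle_trans; [apply Cmod_triangle|].
    eapply Rle_trans; [apply Rplus_le_compat_r, Cmod_triangle|].
    unfold Cdiv. rewrite !Cmod_mult, Hh.
    rewrite Cmod_inv by (intros E; injection E; lra). rewrite Cmod_R, Rabs_pos_eq by lra.
    assert (s * s <= 1)%R by nra. nra. }
  replace (g (z + h) - g z - g1 z * h - g2 * (h * h) / 2) with (g (z + h) - A) in Ht
    by (unfold A; ring).
  pose proof (Cmod_triangle_inv A (g (z + h))) as T.
  rewrite Cmod_minus_sym in T.
  pose proof (Cmod_ge_0 A). pose proof (Cmod_ge_0 (g (z + h))).
  set (u := Cmod (g (z + h))) in *. set (v := Cmod A) in *.
  assert (v ^ 2 - 2 * v * (eta * s ^ 2) <= u ^ 2)%R.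
  { destruct (Rle_dec v (eta * s^2)%R); nra. }
  assert (v * (eta * s ^ 2) <= B * (eta * s ^ 2))%R by (apply Rmult_le_compat_r; nra).
  lra. }
assert (Hs : Cmod s = s) by (rewrite Cmod_R, Rabs_pos_eq; lra).
assert (K1 := K (RtoC s) Hs).
assert (K2 := K (- RtoC s) ltac:(now rewrite Cmod_opp)).
assert (K3 := K (Ci * RtoC s) ltac:(rewrite Cmod_mult, Cmod_Ci, Hs; ring)).
assert (K4 := K (- (Ci * RtoC s)) ltac:(rewrite Cmod_opp, Cmod_mult, Cmod_Ci, Hs; ring)).
(* The cross terms cancel because [i^j] and [i^(2j)] sum to 0 over the four points. With
   coefficients [z, 1, 0] the same identity averages [|z + h|^2]. *)
assert (Id : forall a b c : C,
  (Cmod (a + b * s + c * (s * s) / 2) ^ 2 + Cmod (a + b * - s + c * (- s * - s) / 2) ^ 2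
   + Cmod (a + b * (Ci * s) + c * (Ci * s * (Ci * s)) / 2) ^ 2
   + Cmod (a + b * - (Ci * s) + c * (- (Ci * s) * - (Ci * s)) / 2) ^ 2
   = 4 * Cmod a ^ 2 + 4 * s ^ 2 * Cmod b ^ 2 + s ^ 4 * Cmod c ^ 2)%R).
{ intros a b c.
  replace (c * (s * s) / 2) with (RtoC (s * s / 2) * c) by (rewrite RtoC_div, RtoC_mult by lra; field).
  replace (c * (- s * - s) / 2) with (RtoC (s * s / 2) * c) by (rewrite RtoC_div, RtoC_mult by lra; field).
  replace (c * (Ci * s * (Ci * s)) / 2) with (- (RtoC (s * s / 2) * c)).
  2: { rewrite RtoC_div, RtoC_mult by lra. replace (Ci * s * (Ci * s)) with (Ci * Ci * (s * s)) by ring.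
       replace (Ci * Ci) with (- (1)) by (unfold Ci; apply injective_projections; simpl; ring). field. }
  replace (c * (- (Ci * s) * - (Ci * s)) / 2) with (- (RtoC (s * s / 2) * c)).
  2: { rewrite RtoC_div, RtoC_mult by lra. replace (- (Ci * s) * - (Ci * s)) with (Ci * Ci * (s * s)) by ring.
       replace (Ci * Ci) with (- (1)) by (unfold Ci; apply injective_projections; simpl; ring). field. }
  rewrite !Cmod2_alt. destruct a as [a1 a2], b as [b1 b2], c as [c1 c2]. simpl. field. }
assert (Id2 := Id z 1 0).
rewrite !Cmult_1_l, !Cmult_0_l in Id2. unfold Cdiv in Id2. rewrite !Cmult_0_l, !Cplus_0_r in Id2.
rewrite Cmod_1, Cmod_0 in Id2.
specialize (Id (g z) (g1 z) g2).
assert (0 <= s ^ 4 * Cmod g2 ^ 2)%R by (apply Rmult_le_pos; [nra|apply pow2_ge_0]).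
assert (0 <= 4 * s ^ 2 * Cmod (g1 z) ^ 2)%R by (apply Rmult_le_pos; [nra|apply pow2_ge_0]).
assert (0 < s ^ 2)%R by nra.
assert (B * eta * s ^ 2 <= eps * s ^ 2 / 4)%R by (apply Rle_trans with ((B + 1) * eta * s ^ 2)%R; nra).
nra.
Qed.

(** If no maximum were attained, every point of the disk would be beaten by another one, which by
    semicontinuity also beats a whole neighbourhood. Finitely many neighbourhoods cover the disk,
    and the best of their beaters would be beaten by one of them. *)
Lemma disk_attains_max (Phi : C -> R) (r : R) : (0 <= r)%R ->
  (forall z, (Cmod z <= r)%R -> forall eps : R, (0 < eps)%R -> exists del : R, (0 < del)%R /\
     forall z', (Cmod z' <= r)%R -> (Cmod (z' - z) < del)%R -> (Phi z' < Phi z + eps)%R) ->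
  exists z0, (Cmod z0 <= r)%R /\ forall z, (Cmod z <= r)%R -> (Phi z <= Phi z0)%R.
Proof.
intros Hr Hc. apply NNPP. intros Hno.
assert (Hbig : forall z, (Cmod z <= r)%R -> exists z', (Cmod z' <= r)%R /\ (Phi z < Phi z')%R).
{ intros z Hz. apply NNPP. intros H. apply Hno. exists z. split; auto. intros z' Hz'.
  apply Rnot_lt_le. intros Hl. apply H. now exists z'. }
(* The factor 2 passes from squares to disks: [compactness_list] controls each coordinate by
   [fst p], and the modulus is at most the sum of both. *)
assert (Hloc : forall t : C, exists p : posreal * C, (Cmod (snd p) <= r)%R /\
   forall z', (Cmod z' <= r)%R -> (Cmod (z' - t) < 2 * fst p)%R -> (Phi z' < Phi (snd p))%R).
{ intros t. destruct (Rle_dec (Cmod t) r) as [Ht|Ht].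
  - destruct (Hbig t Ht) as (t' & Ht' & Hl).
    destruct (Hc t Ht (Phi t' - Phi t)%R ltac:(lra)) as (del & Hdel & Hz).
    exists (mkposreal (del / 2) ltac:(lra), t'). split; auto. intros z' H1 H2. simpl in H2 |- *.
    specialize (Hz z' H1 ltac:(lra)). lra.
  (* A point of the square outside the disk: this radius makes its neighbourhood miss the disk, and
     the beater 0 is a dummy. *)
  - exists (mkposreal ((Cmod t - r) / 2) ltac:(lra), RtoC 0). split; [simpl; rewrite Cmod_0; lra|].
    intros z' H1 H2. simpl in H2. rewrite Cmod_minus_sym in H2.
    pose proof (Cmod_triangle_inv t z'). lra. }
pose (p := fun t => proj1_sig (constructive_indefinite_description _ (Hloc t))).
assert (Hp : forall t, (Cmod (snd (p t)) <= r)%R /\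
   forall z', (Cmod z' <= r)%R -> (Cmod (z' - t) < 2 * fst (p t))%R -> (Phi z' < Phi (snd (p t)))%R).
{ intros t. exact (proj2_sig (constructive_indefinite_description _ (Hloc t))). }
pose (toC := fun x : Compactness.Tn 2 R => ((fst x, fst (snd x)) : C)).
(* The square around the disk is covered under a double negation, which the goal [False] absorbs. *)
apply (compactness_list 2 ((- r)%R, ((- r)%R, tt)) (r, (r, tt)) (fun x => fst (p (toC x)))).
intros (l & Hl).
assert (Hcov : forall z, (Cmod z <= r)%R -> exists t, List.In t l /\ (Phi z < Phi (snd (p (toC t))))%R).
{ intros z Hz. destruct (Hl (fst z, (snd z, tt))) as (t & Ht & _ & Hcl).
  - pose proof (re_le_Cmod z) as H1. pose proof (im_le_Cmod z) as H2. unfold Re, Im in *.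
    apply Rabs_le_between in H1. apply Rabs_le_between in H2.
    simpl. repeat split; lra.
  - exists t. split; auto. apply Hp; auto.
    eapply Rle_lt_trans; [apply Cmod_le_re_im|].
    destruct t as [t1 [t2 []]]. destruct z as [z1 z2]. unfold toC in *. simpl in *.
    destruct Hcl as (H1 & H2 & _). unfold Rminus in *. lra. }
assert (Hm : forall l' : list (Compactness.Tn 2 R), l' <> nil ->
   exists t, List.In t l' /\ forall t', List.In t' l' -> (Phi (snd (p (toC t'))) <= Phi (snd (p (toC t))))%R).
{ induction l' as [|t l' IH]; [easy|]. intros _. destruct l' as [|t2 l'].
  - exists t. split; [now left|]. intros t' [->|[]]. lra.
  - destruct IH as (u & Hu & Hmax); [easy|].
    destruct (Rle_dec (Phi (snd (p (toC t)))) (Phi (snd (p (toC u))))) as [H|H].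
    + exists u. split; [now right|]. intros t' [<-|Ht']; auto.
    + exists t. split; [now left|]. intros t' [<-|Ht']; [lra|]. specialize (Hmax t' Ht'). lra. }
destruct (Hm l) as (t & Ht & Hmax).
- intros E. destruct (Hcov (RtoC 0)) as (t & Ht & _); [rewrite Cmod_0; lra|]. now rewrite E in Ht.
- destruct (Hcov (snd (p (toC t)))) as (t' & Ht' & Hlt); [apply Hp|]. specialize (Hmax t' Ht'). lra.
Qed.

(** The punctured disk suits quotients by [z]. The first derivative is a function because it is
    differentiated again; the second is asked for pointwise, as in [no_local_max]. *)
Definition hol2 (g : C -> C) : Prop :=
  exists g1 : C -> C, forall z, (0 < Cmod z < 1)%R -> cderiv g z (g1 z) /\ cdiff g1 z.

Lemma hol2_mult (f g : C -> C) : hol2 f -> hol2 g -> hol2 (fun z => f z * g z).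
Proof.
intros (f1 & Hf) (g1 & Hg). exists (fun z => f1 z * g z + f z * g1 z). intros z Hz.
destruct (Hf z Hz) as (A & f2 & A2). destruct (Hg z Hz) as (B & g2 & B2).
split; [now apply cderiv_mult|]. eexists. apply cderiv_plus; apply cderiv_mult; eassumption.
Qed.

Lemma hol2_const (c : C) : hol2 (fun _ => c).
Proof. exists (fun _ => 0). intros z _. split; [|exists 0]; apply cderiv_const. Qed.

Lemma hol2_id : hol2 (fun z => z).
Proof. exists (fun _ => 1). intros z _. split; [apply cderiv_id|exists 0; apply cderiv_const]. Qed.

Lemma hol2_minus (f g : C -> C) : hol2 f -> hol2 g -> hol2 (fun z => f z - g z).
Proof.
intros (f1 & Hf) (g1 & Hg). exists (fun z => f1 z - g1 z). intros z Hz.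
destruct (Hf z Hz) as (A & f2 & A2). destruct (Hg z Hz) as (B & g2 & B2).
split; [now apply cderiv_minus|]. eexists. apply cderiv_minus; eassumption.
Qed.

Lemma hol2_div (f g : C -> C) : hol2 f -> hol2 g ->
  (forall z, (0 < Cmod z < 1)%R -> g z <> 0) -> hol2 (fun z => f z / g z).
Proof.
intros (f1 & Hf) (g1 & Hg) N. exists (fun z => (f1 z * g z - f z * g1 z) / (g z * g z)). intros z Hz.
destruct (Hf z Hz) as (A & f2 & A2). destruct (Hg z Hz) as (B & g2 & B2).
split; [apply cderiv_div; auto|]. eexists. apply cderiv_div.
- apply cderiv_minus; apply cderiv_mult; eassumption.
- apply cderiv_mult; eassumption.
- apply Cmult_neq_0; auto.
Qed.

Lemma hol2_pow (f : C -> C) (n : nat) : hol2 f -> hol2 (fun z => f z ^ n).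
Proof.
intros Hf. induction n as [|n IH]; [apply (hol2_const 1)|].
exact (hol2_mult f (fun z => f z ^ n) Hf IH).
Qed.

(** After adding [eps |z|^2], a value above [M] would put the maximum over the closed disk neither
    on the circle nor at 0, where [h] vanishes but may lack derivatives; anywhere else
    [no_local_max] applies. *)
Lemma max_principle (h : C -> C) (r M : R) : hol2 h -> ccont h 0 -> h 0 = 0 ->
  (0 < r < 1)%R -> (forall z, Cmod z = r -> (Cmod (h z) <= M)%R) ->
  forall z, (Cmod z <= r)%R -> (Cmod (h z) <= M)%R.
Proof.
intros (h1 & Hh) Hc0 H0 Hr Hb z1 Hz1. apply Rnot_lt_le. intros Hlt.
assert (HM : (0 <= M)%R).
{ eapply Rle_trans; [apply Cmod_ge_0|]. apply (Hb (RtoC r)). rewrite Cmod_R, Rabs_pos_eq; lra. }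
(* Then [eps r^2] is half the excess over [M^2], so on the circle [|h|^2 + eps |z|^2] stays below
   its value at [z1]. *)
set (eps := ((Cmod (h z1) ^ 2 - M ^ 2) / (2 * r ^ 2))%R).
assert (Hr2 : (0 < r ^ 2)%R) by nra.
assert (He : (0 < eps)%R). { apply Rdiv_lt_0_compat; [|lra]. nra. }
assert (He2 : (eps * r ^ 2 = (Cmod (h z1) ^ 2 - M ^ 2) / 2)%R) by (unfold eps; field; lra).
assert (Hcont : forall z, (Cmod z <= r)%R -> ccont h z).
{ intros z Hz. destruct (Req_dec (Cmod z) 0) as [E|E].
  - apply Cmod_eq_0 in E. now rewrite E.
  - pose proof (Cmod_ge_0 z). eapply cderiv_ccont. apply Hh. lra. }
destruct (disk_attains_max (fun z => Cmod (h z) ^ 2 + eps * Cmod z ^ 2)%R r) as (z0 & Hz0 & Hmax); [lra| |].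
{ intros z Hz e Hepos.
  assert (G : ccont (fun x => h x * Cconj (h x) + eps * (x * Cconj x)) z).
  { assert (Hconj : ccont Cconj z).
    { intros d Hd. exists d. split; auto. intros z' Hz'.
      now rewrite <- Cminus_conj, Cmod_conj. }
    assert (Hconj2 : ccont Cconj (h z)).
    { intros d Hd. exists d. split; auto. intros z' Hz'.
      now rewrite <- Cminus_conj, Cmod_conj. }
    apply ccont_plus; apply ccont_mult; auto.
    - apply (ccont_comp Cconj h); auto.
    - apply ccont_const.
    - apply ccont_mult; [apply ccont_id|auto]. }
  destruct (G e Hepos) as (del & Hdel & Hd). exists del. split; auto. intros z' _ Hz'.
  specialize (Hd z' Hz'). rewrite <- !Cmod2_conj in Hd. rewrite <- !RtoC_mult, <- !RtoC_plus, <- RtoC_minus in Hd.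
  rewrite Cmod_R in Hd. apply Rabs_def2 in Hd. lra. }
assert (Hz01 := Hmax z1 Hz1). cbv beta in Hz01.
pose proof (Cmod_ge_0 z1). pose proof (Cmod_ge_0 z0).
assert (Hz1p : (0 <= eps * Cmod z1 ^ 2)%R) by (apply Rmult_le_pos; nra).
assert (Hbig : (M ^ 2 + eps * r ^ 2 < Cmod (h z0) ^ 2 + eps * Cmod z0 ^ 2)%R) by nra.
destruct (Req_dec (Cmod z0) r) as [E|E].
{ specialize (Hb z0 E). rewrite E in Hbig. pose proof (Cmod_ge_0 (h z0)). nra. }
destruct (Req_dec (Cmod z0) 0) as [E0|E0].
{ rewrite (Cmod_eq_0 _ E0), H0, Cmod_0 in Hbig. nra. }
set (rho := Rmin (Cmod z0) (r - Cmod z0)).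
assert (Hrho : (0 < rho)%R) by (apply Rmin_pos; lra).
assert (rho <= Cmod z0)%R by apply Rmin_l.
assert (rho <= r - Cmod z0)%R by apply Rmin_r.
destruct (Hh z0 ltac:(lra)) as (_ & h2 & Hh2).
destruct (no_local_max h h1 z0 h2 rho eps Hrho He) as (k & Hk & Hl); auto.
- intros k Hk. apply Hh. pose proof (Cmod_triangle z0 k).
  pose proof (Cmod_triangle_inv z0 (- k)) as T. rewrite Cmod_opp in T.
  replace (z0 - - k) with (z0 + k) in T by ring. lra.
- assert (Cmod (z0 + k) <= r)%R by (pose proof (Cmod_triangle z0 k); lra).
  specialize (Hmax (z0 + k) ltac:(assumption)). cbv beta in Hmax. lra.
Qed.

(** A bounded singularity at [0] is harmless: apply the maximum principle to [z g^n]
    and let [n] go to infinity. *)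
Lemma max_principle_punctured (g : C -> C) (r M del K : R) : hol2 g -> (0 < r < 1)%R -> (0 < del)%R ->
  (forall z, (0 < Cmod z < del)%R -> (Cmod (g z) <= K)%R) ->
  (forall z, Cmod z = r -> (Cmod (g z) <= M)%R) -> (0 < M)%R ->
  forall z, (0 < Cmod z <= r)%R -> (Cmod (g z) <= M)%R.
Proof.
intros Hg Hr Hdel HK Hb HM z Hz. apply Rnot_lt_le. intros Hlt.
assert (Hn : forall n, (Cmod z * Cmod (g z) ^ n <= r * M ^ n)%R).
{ intros n.
  rewrite <- Cmod_pow, <- Cmod_mult.
  apply (max_principle (fun z => z * g z ^ n) r); try easy.
  - apply (hol2_mult (fun z => z)); [apply hol2_id|now apply hol2_pow].
  - intros e He. pose (K1 := (Rabs K ^ n + 1)%R).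
    assert (P := pow_le (Rabs K) n (Rabs_pos K)).
    assert (HK1 : (0 < K1)%R) by (unfold K1; lra).
    exists (Rmin del (e / K1)). split; [apply Rmin_pos; auto; now apply Rdiv_lt_0_compat|].
    intros z' Hz'. replace (z' - 0) with z' in Hz' by ring.
    replace (z' * g z' ^ n - 0 * g 0 ^ n) with (z' * g z' ^ n) by ring.
    destruct (Req_dec (Cmod z') 0) as [E|E].
    + now rewrite Cmod_mult, E, Rmult_0_l.
    + pose proof (Cmod_ge_0 z').
      assert (Z1 := Rlt_le_trans _ _ _ Hz' (Rmin_l _ _)).
      assert (Z2 := Rlt_le_trans _ _ _ Hz' (Rmin_r _ _)).
      assert (G1 : (Cmod (g z') <= K)%R) by (apply HK; lra).
      rewrite Cmod_mult, Cmod_pow.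
      assert (G2 : (Cmod (g z') ^ n <= Rabs K ^ n)%R).
      { apply pow_incr. split; [apply Cmod_ge_0|]. pose proof (Rle_abs K). lra. }
      assert (Z3 : (Cmod z' * K1 < e)%R).
      { apply Rmult_lt_reg_r with (/ K1)%R; [now apply Rinv_0_lt_compat|].
        rewrite Rmult_assoc, Rinv_r, Rmult_1_r by lra. exact Z2. }
      unfold K1 in Z3. nra.
  - ring.
  - intros z' Hz'. rewrite Cmod_mult, Cmod_pow, Hz'. apply Rmult_le_compat_l; [lra|].
    apply pow_incr. split; [apply Cmod_ge_0|auto]. }
(* This ratio would exceed 1 while all its powers stay below [r / |z|]. *)
set (q := (Cmod (g z) / M)%R).
assert (Hq : (1 < q)%R).
{ unfold q. apply Rmult_lt_reg_r with M; auto. unfold Rdiv. rewrite Rmult_assoc, Rinv_l by lra. lra. }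
assert (Hqn : forall n, (q ^ n <= r / Cmod z)%R).
{ intros n. unfold q, Rdiv. rewrite Rpow_mult_distr, pow_inv.
  assert (0 < M ^ n)%R by now apply pow_lt.
  apply Rmult_le_reg_r with (M ^ n)%R; auto. rewrite Rmult_assoc, Rinv_l, Rmult_1_r by lra.
  apply Rmult_le_reg_l with (Cmod z); [lra|]. specialize (Hn n).
  replace (Cmod z * (r * / Cmod z * M ^ n))%R with (r * M ^ n)%R by (field; lra). exact Hn. }
destruct (Pow_x_infinity q) with (b := (r / Cmod z + 1)%R) as (N & HN).
{ rewrite Rabs_pos_eq; lra. }
specialize (HN N (Nat.le_refl N)). rewrite Rabs_pos_eq in HN by (apply pow_le; lra).
specialize (Hqn N). lra.
Qed.

(** On the circle of radius [r] the hypothesis gives the bound [1/r], which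
    [max_principle_punctured] carries inside; then [r] tends to 1. This is the form of Schwarz's
    lemma used after each division by [z]. *)
Lemma max_principle_disk (g : C -> C) (del K : R) : hol2 g -> (0 < del)%R ->
  (forall z, (0 < Cmod z < del)%R -> (Cmod (g z) <= K)%R) ->
  (forall z, (0 < Cmod z < 1)%R -> (Cmod z * Cmod (g z) <= 1)%R) ->
  forall z, (0 < Cmod z < 1)%R -> (Cmod (g z) <= 1)%R.
Proof.
intros Hg Hdel HK Hb z Hz. apply Rnot_lt_le. intros Hlt.
(* At least [|z|] and beyond [1 / |g z|], so that the bound [1/r] already contradicts the size of
   [g z]. *)
set (r := Rmax (Cmod z) ((1 + / Cmod (g z)) / 2)).
assert (I1 : (0 < / Cmod (g z) < 1)%R).
{ split; [apply Rinv_0_lt_compat; lra|]. rewrite <- Rinv_1. apply Rinv_lt_contravar; lra. }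
assert (Hr : (0 < r < 1)%R).
{ unfold r. split; [eapply Rlt_le_trans; [|apply Rmax_l]; lra|apply Rmax_lub_lt; lra]. }
assert (Hr2 : (/ Cmod (g z) < r)%R).
{ eapply Rlt_le_trans; [|apply Rmax_r]. lra. }
assert (H : (Cmod (g z) <= / r)%R).
{ apply (max_principle_punctured g r (/ r) del K); auto.
  - intros z' Hz'. specialize (Hb z'). rewrite Hz' in Hb. specialize (Hb Hr).
    apply Rmult_le_reg_l with r; [lra|]. rewrite Rinv_r by lra. exact Hb.
  - apply Rinv_0_lt_compat; lra.
  - split; [lra|apply Rmax_l]. }
assert (1 < r * Cmod (g z))%R.
{ apply Rmult_lt_reg_r with (/ Cmod (g z))%R; [lra|]. rewrite Rmult_assoc, Rinv_r by lra. lra. }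
assert (r * Cmod (g z) <= 1)%R.
{ rewrite <- (Rinv_r r) by lra. apply Rmult_le_compat_l; lra. }
lra.
Qed.

(** * Schwarz-Pick estimates for the first three coefficients *)

(** The value at [0] is ignored, so that quotients by [z] need no removable value. *)
Definition bigO (n : nat) (f : C -> C) : Prop :=
  exists K del : R, (0 <= K)%R /\ (0 < del)%R /\
    forall z, (0 < Cmod z < del)%R -> (Cmod (f z) <= K * Cmod z ^ n)%R.

Lemma bigO_ext_loc (n : nat) (f g : C -> C) (r : R) : (0 < r)%R ->
  (forall z, (0 < Cmod z < r)%R -> f z = g z) -> bigO n f -> bigO n g.
Proof.
intros Hr He (K & d & HK & Hd & H). exists K, (Rmin d r). repeat split; auto.
- now apply Rmin_pos.
- intros z [Hz1 Hz2]. rewrite <- He.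
  + apply H. split; auto. eapply Rlt_le_trans; [exact Hz2|apply Rmin_l].
  + split; auto. eapply Rlt_le_trans; [exact Hz2|apply Rmin_r].
Qed.

Lemma bigO_ext (n : nat) (f g : C -> C) :
  (forall z, (0 < Cmod z < 1)%R -> f z = g z) -> bigO n f -> bigO n g.
Proof. apply bigO_ext_loc. lra. Qed.

Lemma bigO_plus (n : nat) (f g : C -> C) : bigO n f -> bigO n g -> bigO n (fun z => f z + g z).
Proof.
intros (K & d & HK & Hd & H) (K' & d' & HK' & Hd' & H').
exists (K + K')%R, (Rmin d d'). repeat split; [lra|now apply Rmin_pos|].
intros z [Hz1 Hz2].
specialize (H z (conj Hz1 (Rlt_le_trans _ _ _ Hz2 (Rmin_l _ _)))).
specialize (H' z (conj Hz1 (Rlt_le_trans _ _ _ Hz2 (Rmin_r _ _)))).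
eapply Rle_trans; [apply Cmod_triangle|]. lra.
Qed.

Lemma bigO_mult (n m : nat) (f g : C -> C) :
  bigO n f -> bigO m g -> bigO (n + m) (fun z => f z * g z).
Proof.
intros (K & d & HK & Hd & H) (K' & d' & HK' & Hd' & H').
exists (K * K')%R, (Rmin d d'). repeat split; [nra|now apply Rmin_pos|].
intros z [Hz1 Hz2].
specialize (H z (conj Hz1 (Rlt_le_trans _ _ _ Hz2 (Rmin_l _ _)))).
specialize (H' z (conj Hz1 (Rlt_le_trans _ _ _ Hz2 (Rmin_r _ _)))).
rewrite Cmod_mult, pow_add.
replace (K * K' * (Cmod z ^ n * Cmod z ^ m))%R with ((K * Cmod z ^ n) * (K' * Cmod z ^ m))%R by ring.
apply Rmult_le_compat; auto; apply Cmod_ge_0.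
Qed.

Lemma bigO_le (n m : nat) (f : C -> C) : (n <= m)%nat -> bigO m f -> bigO n f.
Proof.
intros Hnm (K & d & HK & Hd & H). exists K, (Rmin d 1). repeat split; [auto|apply Rmin_pos; lra|].
intros z [Hz1 Hz2]. assert (Z2 := Rlt_le_trans _ _ _ Hz2 (Rmin_r _ _)).
eapply Rle_trans; [apply H; split; auto; eapply Rlt_le_trans; [exact Hz2|apply Rmin_l]|].
apply Rmult_le_compat_l; auto.
replace m with (n + (m - n))%nat by lia. rewrite pow_add.
rewrite <- (Rmult_1_r (Cmod z ^ n)) at 2. apply Rmult_le_compat_l; [apply pow_le; lra|].
rewrite <- (pow1 (m - n)). apply pow_incr. lra.
Qed.

Lemma bigO_const (c : C) : bigO 0 (fun _ => c).
Proof. exists (Cmod c), 1%R. repeat split; [apply Cmod_ge_0|lra|]. intros; simpl; lra. Qed.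

Lemma bigO_pow (n : nat) : bigO n (fun z => z ^ n).
Proof. exists 1%R, 1%R. repeat split; [lra|lra|]. intros. rewrite Cmod_pow. lra. Qed.

Lemma bigO_scal (n : nat) (c : C) (f : C -> C) : bigO n f -> bigO n (fun z => c * f z).
Proof. exact (bigO_mult 0 n (fun _ => c) f (bigO_const c)). Qed.

Lemma bigO_mono (n k : nat) (c : C) : (n <= k)%nat -> bigO n (fun z => c * z ^ k).
Proof. intros H. apply bigO_scal, (bigO_le n k); auto. apply bigO_pow. Qed.

Lemma bigO_minus (n : nat) (f g : C -> C) : bigO n f -> bigO n g -> bigO n (fun z => f z - g z).
Proof.
intros Hf Hg. apply (bigO_ext n (fun z => f z + (- (1)) * g z)); [intros; ring|].
apply bigO_plus; auto. now apply bigO_scal.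
Qed.

Lemma bigO_div_id (n : nat) (f : C -> C) : bigO (S n) f -> bigO n (fun z => f z / z).
Proof.
intros (K & d & HK & Hd & H). exists K, d. repeat split; auto. intros z Hz.
specialize (H z Hz). rewrite Cmod_div by (apply Cmod_gt_0; lra).
apply Rmult_le_reg_r with (Cmod z); [lra|].
unfold Rdiv. rewrite Rmult_assoc, Rinv_l, Rmult_1_r by lra. simpl in H. lra.
Qed.

Lemma bigO_ccont (f : C -> C) : ccont f 0 -> bigO 0 f.
Proof.
intros H. destruct (ccont_bound f 0 H) as (d & Hd & Hz).
exists (Cmod (f 0) + 1)%R, d. repeat split; [pose proof (Cmod_ge_0 (f 0)); lra|auto|].
intros z Hz'. rewrite pow_O, Rmult_1_r. apply Hz. replace (z - 0) with z by ring. lra.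
Qed.

Lemma bigO_lt (f : C -> C) (e : R) : bigO 1 f -> (0 < e)%R ->
  exists del : R, (0 < del)%R /\ forall z, (0 < Cmod z < del)%R -> (Cmod (f z) < e)%R.
Proof.
intros (K & d & HK & Hd & H) He.
exists (Rmin d (e / (K + 1))). split; [apply Rmin_pos; auto; apply Rdiv_lt_0_compat; lra|].
intros z [Hz1 Hz2].
specialize (H z (conj Hz1 (Rlt_le_trans _ _ _ Hz2 (Rmin_l _ _)))). rewrite pow_1 in H.
assert (Z := Rlt_le_trans _ _ _ Hz2 (Rmin_r _ _)).
assert (Cmod z * (K + 1) < e)%R.
{ apply Rmult_lt_reg_r with (/ (K + 1))%R; [apply Rinv_0_lt_compat; lra|].
  rewrite Rmult_assoc, Rinv_r, Rmult_1_r by lra. exact Z. }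
nra.
Qed.

Lemma bigO_inv (f : C -> C) (c : C) :
  bigO 1 (fun z => f z - c) -> c <> 0 -> bigO 0 (fun z => / f z).
Proof.
intros Hf Hc. assert (P := proj1 (Cmod_gt_0 c) Hc).
destruct (bigO_lt _ (Cmod c / 2) Hf ltac:(lra)) as (d & Hd & H).
exists (/ (Cmod c / 2))%R, d. repeat split; [left; apply Rinv_0_lt_compat; lra|auto|].
intros z Hz. specialize (H z Hz). rewrite Cmod_minus_sym in H.
pose proof (Cmod_triangle_inv c (f z)).
rewrite Cmod_inv by (apply Cmod_gt_0; lra). rewrite pow_O, Rmult_1_r.
apply Rinv_le_contravar; lra.
Qed.

Lemma bigO_limit_le (f : C -> C) (c : C) (B : R) :
  bigO 1 (fun z => f z - c) -> (forall z, (0 < Cmod z < 1)%R -> (Cmod (f z) <= B)%R) ->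
  (Cmod c <= B)%R.
Proof.
intros Hf HB. apply le_epsilon. intros e He.
destruct (bigO_lt _ e Hf He) as (d & Hd & H).
set (m := (Rmin d 1 / 2)%R).
assert (0 < Rmin d 1)%R by (apply Rmin_pos; lra).
pose proof (Rmin_l d 1). pose proof (Rmin_r d 1).
assert (Hm : Cmod m = m) by (rewrite Cmod_R, Rabs_pos_eq; unfold m; lra).
specialize (H (RtoC m)). specialize (HB (RtoC m)). rewrite Hm in *.
specialize (H ltac:(unfold m; lra)). specialize (HB ltac:(unfold m; lra)).
rewrite Cmod_minus_sym in H. pose proof (Cmod_triangle_inv c (f (RtoC m))). lra.
Qed.

(** The difference of the squared moduli factors as [(1 - |a|^2)(1 - |p|^2)]. *)
Lemma Cmod_blaschke (a p : C) : (Cmod a <= 1)%R -> (Cmod p <= 1)%R ->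
  (Cmod (p - a) <= Cmod (1 - Cconj a * p))%R.
Proof.
intros Ha Hp.
assert (A := Cmod_ge_0 a). assert (P := Cmod_ge_0 p).
assert (A2 : (Cmod a ^ 2 <= 1)%R) by nra. assert (P2 : (Cmod p ^ 2 <= 1)%R) by nra.
rewrite Cmod2_alt in A2, P2.
assert (E : (Cmod (1 - Cconj a * p) ^ 2 - Cmod (p - a) ^ 2
   = (1 - (Re a ^ 2 + Im a ^ 2)) * (1 - (Re p ^ 2 + Im p ^ 2)))%R).
{ rewrite !Cmod2_alt. destruct a, p. simpl. ring. }
pose proof (Cmod_ge_0 (p - a)). pose proof (Cmod_ge_0 (1 - Cconj a * p)). nra.
Qed.

Lemma blaschke_denom_ne_0 (a p : C) : (Cmod a < 1)%R -> (Cmod p <= 1)%R -> 1 - Cconj a * p <> 0.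
Proof.
intros Ha Hp. apply Cmod_gt_0.
pose proof (Cmod_triangle_inv 1 (Cconj a * p)) as T.
rewrite Cmod_1, Cmod_mult, Cmod_conj in T.
pose proof (Cmod_ge_0 a). pose proof (Cmod_ge_0 p). nra.
Qed.

(** The Blaschke quotient of [psi] stays in the unit disk, and [psi - a = O(z)] keeps it bounded
    near 0 after division by [z], so [max_principle_disk] restores the bound 1. *)
Lemma schur_step (psi : C -> C) (a : C) : hol2 psi ->
  (forall z, (0 < Cmod z < 1)%R -> (Cmod (psi z) <= 1)%R) ->
  (Cmod a < 1)%R -> bigO 1 (fun z => psi z - a) ->
  hol2 (fun z => (psi z - a) / z / (1 - Cconj a * psi z)) /\
  (forall z, (0 < Cmod z < 1)%R ->
     (Cmod ((psi z - a) / z / (1 - Cconj a * psi z)) <= 1)%R).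
Proof.
intros Hh Hb Ha HO.
assert (Hnz : forall z, (0 < Cmod z < 1)%R -> z <> 0) by (intros z Hz; apply Cmod_gt_0; lra).
assert (Hdn : forall z, (0 < Cmod z < 1)%R -> 1 - Cconj a * psi z <> 0).
{ intros z Hz. apply blaschke_denom_ne_0; auto. }
assert (G : hol2 (fun z => (psi z - a) / z / (1 - Cconj a * psi z))).
{ apply (hol2_div (fun z => (psi z - a) / z) (fun z => 1 - Cconj a * psi z)); auto.
  - apply (hol2_div (fun z => psi z - a) (fun z => z)); auto.
    + apply (hol2_minus psi); [auto|apply hol2_const].
    + apply hol2_id.
  - apply (hol2_minus (fun _ => 1)); [apply hol2_const|].
    apply (hol2_mult (fun _ => Cconj a)); [apply hol2_const|auto]. }
split; auto.
assert (q0 : bigO 0 (fun z => (psi z - a) / z / (1 - Cconj a * psi z))).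
{ apply (bigO_mult 0 0 (fun z => (psi z - a) / z) (fun z => / (1 - Cconj a * psi z))).
  - now apply bigO_div_id.
  - apply bigO_inv with (1 - Cconj a * a).
    + apply (bigO_ext 1 (fun z => - Cconj a * (psi z - a))); [intros; ring|now apply bigO_scal].
    + apply blaschke_denom_ne_0; lra. }
destruct q0 as (K & del & HK & Hdel & HKb).
apply max_principle_disk with del K; auto.
- intros z Hz. specialize (HKb z Hz). now rewrite pow_O, Rmult_1_r in HKb.
- intros z Hz. specialize (Hnz z Hz). specialize (Hdn z Hz).
  rewrite <- Cmod_mult.
  replace (z * ((psi z - a) / z / (1 - Cconj a * psi z))) with
    ((psi z - a) / (1 - Cconj a * psi z)) by (field; auto).
  rewrite Cmod_div by auto.
  assert (P := proj1 (Cmod_gt_0 _) Hdn).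
  apply Rmult_le_reg_r with (Cmod (1 - Cconj a * psi z)); auto.
  unfold Rdiv. rewrite Rmult_assoc, Rinv_l, Rmult_1_r, Rmult_1_l by lra.
  apply Cmod_blaschke; [lra|auto].
Qed.

Lemma one_minus_conj_mult (a : C) : 1 - Cconj a * a = RtoC (1 - Cmod a ^ 2).
Proof. rewrite RtoC_minus, Cmod2_conj. ring. Qed.

Lemma bigO_1_of_2 (psi : C -> C) (x x' : C) :
  bigO 2 (fun z => psi z - x - x' * z) -> bigO 1 (fun z => psi z - x).
Proof.
intros H. apply (bigO_ext 1 (fun z => (psi z - x - x' * z) + x' * z ^ 1)); [intros; simpl; ring|].
apply bigO_plus; [now apply (bigO_le 1 2); auto|apply bigO_mono; auto].
Qed.

(** The Schur transform tends to [x' / (1 - |x|^2)] at 0, and its bound 1 passes to the limit. *)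
Lemma schwarz_pick_strict (psi : C -> C) (x x' : C) : hol2 psi ->
  (forall z, (0 < Cmod z < 1)%R -> (Cmod (psi z) <= 1)%R) ->
  bigO 2 (fun z => psi z - x - x' * z) -> (Cmod x < 1)%R ->
  (Cmod x' <= 1 - Cmod x ^ 2)%R.
Proof.
intros Hh Hb HO Hx. assert (HO1 := bigO_1_of_2 _ _ _ HO).
destruct (schur_step psi x Hh Hb Hx HO1) as [_ HG].
pose proof (Cmod_ge_0 x).
set (q := (1 - Cmod x ^ 2)%R). assert (Hq : (0 < q)%R) by (unfold q; nra).
assert (Hq0 : RtoC q <> 0) by (intros E; injection E; lra).
assert (Hdn : forall z, (0 < Cmod z < 1)%R -> 1 - Cconj x * psi z <> 0).
{ intros z Hz. apply blaschke_denom_ne_0; auto. }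
assert (HQ : bigO 1 (fun z => (1 - Cconj x * psi z) - q)).
{ apply (bigO_ext 1 (fun z => - Cconj x * (psi z - x))); [|now apply bigO_scal].
  intros. unfold q. rewrite <- one_minus_conj_mult. ring. }
assert (L : (Cmod (x' / q) <= 1)%R).
{ eapply bigO_limit_le; [|exact HG].
  apply (bigO_ext 1 (fun z => ((psi z - x - x' * z) / z - x' / q * (1 - Cconj x * psi z - q))
       * / (1 - Cconj x * psi z))).
  - intros z Hz. assert (z <> 0) by (apply Cmod_gt_0; lra). specialize (Hdn z Hz). field. auto.
  - apply (bigO_mult 1 0).
    + apply bigO_minus; [now apply bigO_div_id|now apply bigO_scal].
    + apply bigO_inv with (RtoC q); auto. }
rewrite Cmod_div, Cmod_R, Rabs_pos_eq in L by (auto; lra).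
apply Rmult_le_reg_r with (/ q)%R; [now apply Rinv_0_lt_compat|].
rewrite Rinv_r by lra. exact L.
Qed.

Lemma scaled_disk_bound (psi : C -> C) (s : R) : (0 < s < 1)%R ->
  (forall z, (0 < Cmod z < 1)%R -> (Cmod (psi z) <= 1)%R) ->
  forall z, (0 < Cmod z < 1)%R -> (Cmod (s * psi z) <= 1)%R.
Proof.
intros Hs Hb z Hz. specialize (Hb z Hz). rewrite Cmod_mult, Cmod_R, Rabs_pos_eq by lra.
pose proof (Cmod_ge_0 (psi z)). nra.
Qed.

(** When [|x| = 1] the Schur denominator tends to 0 at the origin; the strict case for [s * psi],
    with [s] tending to 1, covers this too. *)
Lemma schwarz_pick (psi : C -> C) (x x' : C) : hol2 psi ->
  (forall z, (0 < Cmod z < 1)%R -> (Cmod (psi z) <= 1)%R) ->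
  bigO 2 (fun z => psi z - x - x' * z) ->
  (Cmod x <= 1)%R /\ (Cmod x' <= 1 - Cmod x ^ 2)%R.
Proof.
intros Hh Hb HO.
assert (Hx : (Cmod x <= 1)%R).
{ eapply bigO_limit_le; [|exact Hb]. eapply bigO_1_of_2; exact HO. }
split; auto. pose proof (Cmod_ge_0 x). pose proof (Cmod_ge_0 x').
assert (S : forall s : R, (0 < s < 1)%R -> (s * Cmod x' <= 1 - (s * Cmod x) ^ 2)%R).
{ intros s Hs. assert (Es : Cmod s = s) by (rewrite Cmod_R, Rabs_pos_eq; lra).
  rewrite <- Es, <- !Cmod_mult.
  apply schwarz_pick_strict with (fun z => s * psi z).
  - apply (hol2_mult (fun _ => RtoC s)); [apply hol2_const|auto].
  - now apply scaled_disk_bound.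
  - apply (bigO_ext 2 (fun z => s * (psi z - x - x' * z))); [intros; ring|now apply bigO_scal].
  - rewrite Cmod_mult, Es. nra. }
apply le_epsilon. intros e He.
(* With [s = 1 - t] the loss is at most [t (|x'| + 2 |x|^2)], hence at most [t * B]. *)
set (B := (Cmod x' + 2)%R). assert (HB : (0 < B)%R) by (unfold B; lra).
set (t := Rmin (1 / 2) (e / B)).
assert (Ht : (0 < t)%R) by (apply Rmin_pos; [lra|now apply Rdiv_lt_0_compat]).
assert (Ht1 : (t <= 1 / 2)%R) by apply Rmin_l.
assert (Ht2 : (t * B <= e)%R).
{ apply Rmult_le_reg_r with (/ B)%R; [now apply Rinv_0_lt_compat|].
  rewrite Rmult_assoc, Rinv_r, Rmult_1_r by lra. apply Rmin_r. }
specialize (S (1 - t)%R ltac:(lra)). unfold B in Ht2.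
assert (Cmod x ^ 2 <= 1)%R by nra. nra.
Qed.

(** This is [schwarz_pick] for the Schur transform of [psi], cleared of the denominator [q^2] with
    [q = 1 - |c1|^2]. *)
Lemma schur_third_strict (psi : C -> C) (c1 c2 c3 : C) : hol2 psi ->
  (forall z, (0 < Cmod z < 1)%R -> (Cmod (psi z) <= 1)%R) ->
  bigO 3 (fun z => psi z - c1 - c2 * z - c3 * z ^ 2) -> (Cmod c1 < 1)%R ->
  (Cmod (c3 * RtoC (1 - Cmod c1 ^ 2) + Cconj c1 * c2 ^ 2)
     <= (1 - Cmod c1 ^ 2) ^ 2 - Cmod c2 ^ 2)%R.
Proof.
intros Hh Hb HO Hx.
assert (HO2 : bigO 2 (fun z => psi z - c1 - c2 * z)).
{ apply (bigO_ext 2 (fun z => (psi z - c1 - c2 * z - c3 * z ^ 2) + c3 * z ^ 2)); [intros; ring|].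
  apply bigO_plus; [now apply (bigO_le 2 3); auto|apply bigO_mono; auto]. }
assert (HO1 := bigO_1_of_2 _ _ _ HO2).
destruct (schur_step psi c1 Hh Hb Hx HO1) as [HG HGb].
pose proof (Cmod_ge_0 c1).
set (q := (1 - Cmod c1 ^ 2)%R). assert (Hq : (0 < q)%R) by (unfold q; nra).
assert (Hq0 : RtoC q <> 0) by (intros E; injection E; lra).
assert (Hqe : RtoC q = 1 - Cconj c1 * c1) by (unfold q; now rewrite one_minus_conj_mult).
assert (Hdn : forall z, (0 < Cmod z < 1)%R -> 1 - Cconj c1 * psi z <> 0).
{ intros z Hz. apply blaschke_denom_ne_0; auto. }
(* If the Schur transform begins with [g0 + g1 z], comparing coefficients in [(psi - c1)/z = (g0 +
   g1 z)(1 - conj c1 * psi)] gives [g0 q = c2] and [g1 q = c3 + conj c1 * c2 * g0]. *)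
destruct (schwarz_pick _ (c2 / q) ((c3 + Cconj c1 * c2 * (c2 / q)) / q) HG HGb) as [_ L].
- apply (bigO_ext 2 (fun z => ((psi z - c1 - c2 * z - c3 * z ^ 2) / z
      - (c2 / q) * (- Cconj c1 * (psi z - c1 - c2 * z))
      - ((c3 + Cconj c1 * c2 * (c2 / q)) / q) * (z ^ 1 * (- Cconj c1 * (psi z - c1))))
       * / (1 - Cconj c1 * psi z))).
  + intros z Hz. assert (z <> 0) by (apply Cmod_gt_0; lra). specialize (Hdn z Hz).
    rewrite Hqe in *. simpl. field. auto.
  + apply (bigO_mult 2 0).
    * apply bigO_minus; [apply bigO_minus|].
      -- now apply bigO_div_id.
      -- now repeat apply bigO_scal.
      -- apply bigO_scal. apply (bigO_mult 1 1); [apply bigO_pow|now apply bigO_scal].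
    * apply bigO_inv with (RtoC q); auto.
      apply (bigO_ext 1 (fun z => - Cconj c1 * (psi z - c1))); [|now apply bigO_scal].
      intros. rewrite Hqe. ring.
- replace ((c3 + Cconj c1 * c2 * (c2 / q)) / q) with ((c3 * q + Cconj c1 * c2 ^ 2) / (q * q)) in L
    by (simpl; field; auto).
  rewrite !Cmod_div in L by (auto; apply Cmult_neq_0; auto).
  rewrite Cmod_mult, Cmod_R, Rabs_pos_eq in L by lra.
  set (E := Cmod (c3 * q + Cconj c1 * c2 ^ 2)) in *.
  assert (E = E / (q * q) * (q * q))%R by (field; lra).
  assert (q ^ 2 - Cmod c2 ^ 2 = (1 - (Cmod c2 / q) ^ 2) * (q * q))%R by (field; lra).
  assert (0 < q * q)%R by nra. nra.
Qed.

(** The case [|c1| = 1] is separate because the last inequality would then read [0 <= 0] and say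
    nothing about [c3]. *)
Lemma schur_third (psi : C -> C) (c1 c2 c3 : C) : hol2 psi ->
  (forall z, (0 < Cmod z < 1)%R -> (Cmod (psi z) <= 1)%R) ->
  bigO 3 (fun z => psi z - c1 - c2 * z - c3 * z ^ 2) ->
  (Cmod c1 = 1 /\ c2 = 0 /\ c3 = 0) \/
  ((Cmod c1 < 1)%R /\ (Cmod c2 <= 1 - Cmod c1 ^ 2)%R /\
   (Cmod (c3 * RtoC (1 - Cmod c1 ^ 2) + Cconj c1 * c2 ^ 2)
     <= (1 - Cmod c1 ^ 2) ^ 2 - Cmod c2 ^ 2)%R).
Proof.
intros Hh Hb HO.
assert (HO2 : bigO 2 (fun z => psi z - c1 - c2 * z)).
{ apply (bigO_ext 2 (fun z => (psi z - c1 - c2 * z - c3 * z ^ 2) + c3 * z ^ 2)); [intros; ring|].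
  apply bigO_plus; [now apply (bigO_le 2 3); auto|apply bigO_mono; auto]. }
destruct (schwarz_pick psi c1 c2 Hh Hb HO2) as [H1 H2].
destruct (Rlt_dec (Cmod c1) 1) as [Hl|Hl].
{ right. split; [auto|split; [auto|]]. now apply schur_third_strict with psi. }
left. assert (E1 : Cmod c1 = 1%R) by lra. split; auto.
assert (E2 : c2 = 0). { apply Cmod_eq_0. rewrite E1 in H2. pose proof (Cmod_ge_0 c2). lra. }
split; auto. subst c2.
apply Cmod_eq_0. apply Rle_antisym; [|apply Cmod_ge_0].
(* For [s * psi] the strict inequality is [s |c3| (1 - s^2) <= (1 - s^2)^2]; dividing by [1 - s^2]
   leaves a bound that vanishes as [s] tends to 1. *)
assert (S : forall s : R, (0 < s < 1)%R -> (s * Cmod c3 <= 1 - s ^ 2)%R).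
{ intros s Hs. assert (Es : Cmod s = s) by (rewrite Cmod_R, Rabs_pos_eq; lra).
  assert (T := schur_third_strict (fun z => s * psi z) (s * c1) 0 (s * c3)).
  rewrite Cmod_mult, Es, E1, Rmult_1_r, Cmod_0 in T.
  replace (s * c3 * RtoC (1 - s ^ 2) + Cconj (s * c1) * 0 ^ 2) with (s * c3 * RtoC (1 - s ^ 2)) in T
    by (simpl; ring).
  rewrite !Cmod_mult, Es, Cmod_R, Rabs_pos_eq in T by nra.
  assert (T' : (s * Cmod c3 * (1 - s ^ 2) <= (1 - s ^ 2) ^ 2 - 0 ^ 2)%R).
  { apply T; [| |  |lra].
    - apply (hol2_mult (fun _ => RtoC s)); [apply hol2_const|auto].
    - now apply scaled_disk_bound.
    - apply (bigO_ext 3 (fun z => s * (psi z - c1 - 0 * z - c3 * z ^ 2))); [intros; ring|now apply bigO_scal]. }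
  apply Rmult_le_reg_r with (1 - s ^ 2)%R; nra. }
apply le_epsilon. intros e He. rewrite Rplus_0_l.
pose proof (Cmod_ge_0 c3).
set (B := (Cmod c3 + 2)%R). assert (HB : (0 < B)%R) by (unfold B; lra).
set (t := Rmin (1 / 2) (e / B)).
assert (Ht : (0 < t)%R) by (apply Rmin_pos; [lra|now apply Rdiv_lt_0_compat]).
assert (Ht1 : (t <= 1 / 2)%R) by apply Rmin_l.
assert (Ht2 : (t * B <= e)%R).
{ apply Rmult_le_reg_r with (/ B)%R; [now apply Rinv_0_lt_compat|].
  rewrite Rmult_assoc, Rinv_r, Rmult_1_r by lra. apply Rmin_r. }
specialize (S (1 - t)%R ltac:(lra)). unfold B in Ht2. nra.
Qed.

(** Here [c = |c1|] and [k = |c2|]; the left side is [1 - c^2] times the bound that the triangle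
    inequality yields for the Hankel expression. *)
Lemma hankel_real_bound (c k : R) : (0 <= c < 1)%R -> (0 <= k <= 1 - c ^ 2)%R ->
  (c * ((1 - c ^ 2) ^ 2 - k ^ 2) / 3 + (1 - c ^ 2) * c ^ 2 * k / 6 + (1 - c ^ 2) * c ^ 4 / 18
   + k ^ 2 * (c ^ 2 / 3 + (1 - c ^ 2) / 4) <= (1 - c ^ 2) / 4)%R.
Proof.
intros Hc Hk. set (m := (1 - c ^ 2)%R) in *.
assert (Hm : (0 <= m)%R) by lra.
assert (D : (0 <= (m - k) * ((m + k) * ((1 - c) * (3 - c) / 12) + m * c ^ 2 / 6))%R).
{ apply Rmult_le_pos; [lra|]. apply Rplus_le_le_0_compat.
  - apply Rmult_le_pos; [lra|]. nra.
  - apply Rmult_le_pos; [|lra]. nra. }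
assert (T : (0 <= m * (c ^ 4 * (7 / 36)))%R).
{ apply Rmult_le_pos; [lra|]. assert (0 <= c ^ 4)%R by (apply pow_le; lra). lra. }
(* At [k = m] the slack is [7/36 m c^4]; the rest is divisible by [m - k], with a nonnegative
   cofactor. *)
assert (E : (m / 4 - (c * (m ^ 2 - k ^ 2) / 3 + m * c ^ 2 * k / 6 + m * c ^ 4 / 18
   + k ^ 2 * (c ^ 2 / 3 + m / 4)) =
   (m - k) * ((m + k) * ((1 - c) * (3 - c) / 12) + m * c ^ 2 / 6) + m * (c ^ 4 * (7 / 36)))%R).
{ unfold m. field. }
lra.
Qed.

(** Schur's inequality controls not [c3] but [E = m c3 + conj c1 * c2^2]. After multiplication by
    [m], substituting [E] leaves a multiple of [c1 * conj c1 = c^2], which is real and joins the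
    [c2^2] term before moduli are taken. *)
Lemma hankel_schwarz_bound (psi : C -> C) (c1 c2 c3 : C) : hol2 psi ->
  (forall z, (0 < Cmod z < 1)%R -> (Cmod (psi z) <= 1)%R) ->
  bigO 3 (fun z => psi z - c1 - c2 * z - c3 * z ^ 2) ->
  (Cmod (c1 * c3 / 3 + c1 ^ 2 * c2 / 6 - c1 ^ 4 / 18 - c2 ^ 2 / 4) <= / 4)%R.
Proof.
intros Hh Hb HO.
assert (Cn : forall x : R, (0 < x)%R -> RtoC x <> 0) by (intros x Hx E; injection E; lra).
destruct (schur_third psi c1 c2 c3 Hh Hb HO) as [(E1 & -> & ->)|(H1 & H2 & H3)].
- replace (c1 * 0 / 3 + c1 ^ 2 * 0 / 6 - c1 ^ 4 / 18 - 0 ^ 2 / 4) with (- (c1 ^ 4 / 18)) by (simpl; field).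
  rewrite Cmod_opp, Cmod_div, Cmod_pow, E1, pow1, Cmod_R, Rabs_pos_eq by (try apply Cn; lra). lra.
- set (c := Cmod c1) in *. set (k := Cmod c2) in *. set (m := (1 - c ^ 2)%R) in *.
  assert (Hc : (0 <= c)%R) by apply Cmod_ge_0. assert (Hk : (0 <= k)%R) by apply Cmod_ge_0.
  assert (Hm : (0 < m)%R) by (unfold m; nra).
  assert (Hb2 := hankel_real_bound c k ltac:(lra) ltac:(fold m; lra)). fold m in Hb2.
  set (E := c3 * RtoC m + Cconj c1 * c2 ^ 2) in *.
  apply Rmult_le_reg_l with m; auto.
  replace m with (Cmod m) at 1 by (rewrite Cmod_R, Rabs_pos_eq; lra).
  rewrite <- Cmod_mult.
  replace (m * (c1 * c3 / 3 + c1 ^ 2 * c2 / 6 - c1 ^ 4 / 18 - c2 ^ 2 / 4)) with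
   (c1 * E * RtoC (/ 3) + c1 ^ 2 * c2 * RtoC (m / 6) - c1 ^ 4 * RtoC (m / 18)
     - c2 ^ 2 * RtoC (c ^ 2 / 3 + m / 4)).
  2: { rewrite RtoC_plus, !RtoC_div, RtoC_inv by lra. unfold c at 1. rewrite Cmod2_conj.
       unfold E. simpl. field. }
  eapply Rle_trans; [apply Cmod_triangle_minus|].
  eapply Rle_trans; [apply Rplus_le_compat_r, Cmod_triangle_minus|].
  eapply Rle_trans; [apply Rplus_le_compat_r, Rplus_le_compat_r, Cmod_triangle|].
  rewrite !Cmod_mult, !Cmod_pow, !Cmod_R. fold c k.
  rewrite !Rabs_pos_eq by nra.
  assert (c * Cmod E <= c * (m ^ 2 - k ^ 2))%R by (apply Rmult_le_compat_l; auto).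
  lra.
Qed.

(** * Complex power series *)

Notation Cps := (@is_pseries C_AbsRing C_NormedModule).

(** Sums over indices strictly below [n], one term less than [sum_n], so that [Csum _ n] pairs with
    a remainder of order [n]. *)
Fixpoint Csum (u : nat -> C) (n : nat) : C :=
  match n with O => 0 | S m => Csum u m + u m end.

Definition Cser (u : nat -> C) (l : C) : Prop :=
  forall eps : R, (0 < eps)%R -> exists N, forall n, (N <= n)%nat -> (Cmod (Csum u n - l) < eps)%R.

Lemma sum_n_Csum (u : nat -> C) (n : nat) : @sum_n C_AbelianMonoid u n = Csum u (S n).
Proof.
induction n as [|n IH].
- rewrite sum_O. simpl. ring.
- rewrite sum_Sn, IH. reflexivity.
Qed.

Lemma Csum_ext (u v : nat -> C) (n : nat) : (forall k, (k < n)%nat -> u k = v k) -> Csum u n = Csum v n.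
Proof.
induction n as [|n IH]; intros H; simpl; auto. rewrite IH, H; auto.
Qed.

Lemma Csum_S (u : nat -> C) (n : nat) : Csum u (S n) = u O + Csum (fun k => u (S k)) n.
Proof.
induction n as [|n IH]; [simpl; ring|].
change (Csum u (S n) + u (S n) = u O + (Csum (fun k => u (S k)) n + u (S n))). rewrite IH. ring.
Qed.

Lemma Csum_last (u : nat -> C) (n : nat) : Csum u (S n) = Csum u n + u n.
Proof. reflexivity. Qed.

Lemma Csum_plus (u v : nat -> C) (n : nat) : Csum (fun k => u k + v k) n = Csum u n + Csum v n.
Proof. induction n as [|n IH]; simpl; [ring|rewrite IH; ring]. Qed.

Lemma Csum_scal (c : C) (u : nat -> C) (n : nat) : Csum (fun k => c * u k) n = c * Csum u n.
Proof. induction n as [|n IH]; simpl; [ring|rewrite IH; ring]. Qed.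

Lemma Cser_is_series (u : nat -> C) (l : C) :
  Cser u l <-> @is_series C_AbsRing C_NormedModule u l.
Proof.
unfold is_series. rewrite (@filterlim_locally_ball_norm C_AbsRing nat C_NormedModule eventually _). split.
- intros H [e He]. destruct (H e He) as (N & HN). exists N. intros n Hn.
  change (Cmod (@sum_n C_AbelianMonoid u n - l) < e)%R. rewrite sum_n_Csum. apply HN. lia.
- intros H e He. destruct (H (mkposreal e He)) as (N & HN). exists (S N). intros n Hn.
  destruct n as [|n]; [lia|]. specialize (HN n ltac:(lia)).
  change (Cmod (@sum_n C_AbelianMonoid u n - l) < e)%R in HN. now rewrite sum_n_Csum in HN.
Qed.

Lemma Cser_ext (u v : nat -> C) (l : C) : (forall n, u n = v n) -> Cser u l -> Cser v l.
Proof.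
intros E H e He. destruct (H e He) as (N & HN). exists N. intros n Hn.
rewrite <- (Csum_ext u); auto.
Qed.

Lemma Cps_Cser (a : nat -> C) (z l : C) : Cps a z l <-> Cser (fun k => a k * z ^ k) l.
Proof.
unfold is_pseries. rewrite <- Cser_is_series.
split; apply Cser_ext; intros n; change (@pow_n C_AbsRing z n) with (@pow_n C_Ring z n);
 change (scal (pow_n z n) (a n)) with (z ^ n * a n); ring.
Qed.

Lemma Cser_unique (u : nat -> C) (l l' : C) : Cser u l -> Cser u l' -> l = l'.
Proof.
intros H H'. apply Cminus_eq_0, Cmod_eq_0, Rle_antisym; [|apply Cmod_ge_0].
apply le_epsilon. intros e He. rewrite Rplus_0_l.
destruct (H (e/2)%R ltac:(lra)) as (N & HN). destruct (H' (e/2)%R ltac:(lra)) as (N' & HN').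
specialize (HN (N + N')%nat ltac:(lia)). specialize (HN' (N + N')%nat ltac:(lia)).
set (s := Csum u (N + N')) in *.
replace (l - l') with ((s - l') - (s - l)) by ring.
eapply Rle_trans; [apply Cmod_triangle_minus|]. lra.
Qed.

Lemma Cser_plus (u v : nat -> C) (l l' : C) : Cser u l -> Cser v l' -> Cser (fun n => u n + v n) (l + l').
Proof.
intros H H' e He.
destruct (H (e/2)%R ltac:(lra)) as (N & HN). destruct (H' (e/2)%R ltac:(lra)) as (N' & HN').
exists (N + N')%nat. intros n Hn. specialize (HN n ltac:(lia)). specialize (HN' n ltac:(lia)).
rewrite Csum_plus. replace (Csum u n + Csum v n - (l + l')) with ((Csum u n - l) + (Csum v n - l')) by ring.
eapply Rle_lt_trans; [apply Cmod_triangle|]. lra.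
Qed.

Lemma Cser_scal (c : C) (u : nat -> C) (l : C) : Cser u l -> Cser (fun n => c * u n) (c * l).
Proof.
intros H e He. pose proof (Cmod_ge_0 c).
destruct (H (e / (Cmod c + 1))%R ltac:(apply Rdiv_lt_0_compat; lra)) as (N & HN).
exists N. intros n Hn. specialize (HN n Hn). rewrite Csum_scal.
replace (c * Csum u n - c * l) with (c * (Csum u n - l)) by ring. rewrite Cmod_mult.
assert (Cmod (Csum u n - l) * (Cmod c + 1) < e)%R.
{ apply Rmult_lt_reg_r with (/ (Cmod c + 1))%R; [apply Rinv_0_lt_compat; lra|].
  rewrite Rmult_assoc, Rinv_r, Rmult_1_r by lra. exact HN. }
pose proof (Cmod_ge_0 (Csum u n - l)). nra.
Qed.

Lemma Cser_cons (u : nat -> C) (l : C) : Cser (fun n => u (S n)) l -> Cser u (u O + l).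
Proof.
intros H e He. destruct (H e He) as (N & HN). exists (S N). intros n Hn.
destruct n as [|n]; [lia|]. rewrite Csum_S.
replace (u O + Csum (fun k => u (S k)) n - (u O + l)) with (Csum (fun k => u (S k)) n - l) by ring.
apply HN. lia.
Qed.

Lemma Cps_scal_plus (a b c : nat -> C) (s t z la lb : C) :
  (forall n, c n = s * a n + t * b n) -> Cps a z la -> Cps b z lb -> Cps c z (s * la + t * lb).
Proof.
rewrite !Cps_Cser. intros E Ha Hb.
apply (Cser_ext (fun n => s * (a n * z ^ n) + t * (b n * z ^ n))).
- intros n. rewrite E. ring.
- apply Cser_plus; now apply Cser_scal.
Qed.

Lemma Cps_cons (a : nat -> C) (z l : C) : Cps (fun n => a (S n)) z l -> Cps a z (a O + z * l).
Proof.
rewrite !Cps_Cser. intros H. replace (a O + z * l) with (a O * z ^ 0 + z * l) by (simpl; ring).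
apply (Cser_cons (fun n => a n * z ^ n)).
apply (Cser_ext (fun n => z * (a (S n) * z ^ n))); [intros; simpl; ring|now apply Cser_scal].
Qed.

Lemma Cps_unique (a : nat -> C) (z l l' : C) : Cps a z l -> Cps a z l' -> l = l'.
Proof. rewrite !Cps_Cser. apply Cser_unique. Qed.

Lemma Cser_term_bound (u : nat -> C) (l : C) : Cser u l -> exists M, forall n, (Cmod (u n) <= M)%R.
Proof.
intros H. destruct (H 1%R ltac:(lra)) as (N & HN).
(* The floor 2 covers the terms past [N], each a difference of two partial sums within 1 of the
   limit. *)
assert (Hfin : forall m, exists M, (2 <= M)%R /\ forall n, (n < m)%nat -> (Cmod (u n) <= M)%R).
{ induction m as [|m (M & HM & IH)].
  - exists 2%R. split; [lra|]. intros; lia.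
  - exists (Rmax M (Cmod (u m))). split; [eapply Rle_trans; [exact HM|apply Rmax_l]|].
    intros n Hn. destruct (Nat.eq_dec n m) as [->|Hne]; [apply Rmax_r|].
    eapply Rle_trans; [apply IH; lia|apply Rmax_l]. }
destruct (Hfin N) as (M & HM & HMb). exists M. intros n.
destruct (Nat.lt_ge_cases n N) as [Hlt|Hge]; auto.
assert (H1 := HN n Hge). assert (H2 := HN (S n) ltac:(lia)). simpl in H2.
replace (u n) with ((Csum u n + u n - l) - (Csum u n - l)) by ring.
eapply Rle_trans; [apply Cmod_triangle_minus|]. lra.
Qed.

Definition conv_D (a : nat -> C) : Prop := forall z, inD z -> exists l, Cps a z l.

(** Convergence at a larger radius bounds the terms there. This hands absolute convergence and
    termwise differentiation over to the real series of moduli. *)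
Lemma conv_D_radius (a : nat -> C) (r : R) : conv_D a -> (0 <= r < 1)%R ->
  Rbar_lt (Rabs r) (CV_radius (fun n => Cmod (a n))).
Proof.
intros Ha Hr. set (r' := ((r + 1) / 2)%R).
assert (Hr' : Cmod r' = r') by (rewrite Cmod_R, Rabs_pos_eq; unfold r'; lra).
assert (Hle : Rbar_le r' (CV_radius (fun n => Cmod (a n)))).
{ apply (proj1 (CV_radius_bounded (fun n => Cmod (a n)))).
  destruct (Ha (RtoC r')) as (l & Hl); [unfold inD; rewrite Hr'; unfold r'; lra|].
  apply Cps_Cser in Hl. destruct (Cser_term_bound _ _ Hl) as (M & HM). exists M. intros n.
  specialize (HM n). rewrite Cmod_mult, Cmod_pow, Hr' in HM.
  rewrite Rabs_pos_eq; auto. apply Rmult_le_pos; [apply Cmod_ge_0|apply pow_le; unfold r'; lra]. }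
eapply Rbar_lt_le_trans; [|exact Hle]. simpl. rewrite Rabs_pos_eq by lra. unfold r'. lra.
Qed.

Lemma ex_Cser_le (u : nat -> C) (b : nat -> R) :
  (forall n, (Cmod (u n) <= b n)%R) -> ex_series b -> exists l, Cser u l.
Proof.
intros H Hb.
destruct (@ex_series_le C_AbsRing C_CompleteNormedModule u b H Hb) as (l & Hl).
exists l. apply Cser_is_series. exact Hl.
Qed.

Lemma conv_D_le (a : nat -> C) (b : nat -> R) :
  (forall n, (Cmod (a n) <= b n)%R) ->
  (forall r : R, (0 <= r < 1)%R -> ex_pseries b r) -> conv_D a.
Proof.
intros Hab Hb z Hz. pose proof (Cmod_ge_0 z). unfold inD in Hz.
destruct (ex_Cser_le (fun k => a k * z ^ k) (fun n => b n * Cmod z ^ n)%R) as (l & Hl).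
- intros n. rewrite Cmod_mult, Cmod_pow. apply Rmult_le_compat_r; [apply pow_le|]; auto.
- apply ex_pseries_R. apply Hb. lra.
- exists l. now apply Cps_Cser.
Qed.

Definition Cps_derive (a : nat -> C) (n : nat) : C := RtoC (INR (S n)) * a (S n).

Lemma Cmod_Cps_derive (a : nat -> C) (n : nat) :
  Cmod (Cps_derive a n) = PS_derive (fun n => Cmod (a n)) n.
Proof.
unfold Cps_derive, PS_derive. rewrite Cmod_mult, Cmod_R, Rabs_pos_eq; auto. apply pos_INR.
Qed.

Lemma conv_D_derive (a : nat -> C) : conv_D a -> conv_D (Cps_derive a).
Proof.
intros Ha. apply conv_D_le with (PS_derive (fun n => Cmod (a n))).
- intros n. rewrite Cmod_Cps_derive. lra.
- intros r Hr. apply ex_pseries_derive. now apply conv_D_radius.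
Qed.

Lemma conv_D_tail (a : nat -> C) : conv_D a -> conv_D (fun n => a (S n)).
Proof.
intros Ha. apply conv_D_le with (PS_derive (fun n => Cmod (a n))).
- intros n. unfold PS_derive. rewrite S_INR.
  pose proof (Cmod_ge_0 (a (S n))). pose proof (pos_INR n). nra.
- intros r Hr. apply ex_pseries_derive. now apply conv_D_radius.
Qed.

(** A limit picked by choice, arbitrary where the series diverges. *)
Definition Cpsum (a : nat -> C) (z : C) : C := epsilon (inhabits (RtoC 0)) (fun l => Cps a z l).

Lemma Cpsum_spec (a : nat -> C) (z : C) : conv_D a -> inD z -> Cps a z (Cpsum a z).
Proof. intros Ha Hz. apply (epsilon_spec (inhabits (RtoC 0)) (fun l => Cps a z l)). now apply Ha. Qed.

Lemma Cpsum_eq (a : nat -> C) (z l : C) : Cps a z l -> Cpsum a z = l.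
Proof.
intros H. apply (Cps_unique a z); auto.
apply (epsilon_spec (inhabits (RtoC 0)) (fun l => Cps a z l)). now exists l.
Qed.

(** The constant, twice the sharp one, is the factor that two applications of [PS_derive] put on a
    coefficient. The induction writes the next remainder as [z'] times the current one plus
    [(n + 2) z^(n+1) (z' - z)^2]. *)
Lemma Cpow_minus_bound (z z' : C) (rho : R) (n : nat) : (Cmod z <= rho)%R -> (Cmod z' <= rho)%R ->
  (Cmod (z' ^ S (S n) - z ^ S (S n) - RtoC (INR (S (S n))) * z ^ S n * (z' - z))
    <= INR (S n) * INR (S (S n)) * rho ^ n * Cmod (z' - z) ^ 2)%R.
Proof.
intros Hz Hz'. pose proof (Cmod_ge_0 z). pose proof (Cmod_ge_0 z').
pose proof (pow2_ge_0 (Cmod (z' - z))) as P2.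
induction n as [|n IH].
- replace (z' ^ 2 - z ^ 2 - RtoC (INR 2) * z ^ 1 * (z' - z)) with ((z' - z) ^ 2).
  2: { replace (INR 2) with 2%R by (simpl; ring). simpl. ring. }
  rewrite Cmod_pow. simpl INR. simpl (rho ^ 0)%R. nra.
- replace (z' ^ S (S (S n)) - z ^ S (S (S n)) - RtoC (INR (S (S (S n)))) * z ^ S (S n) * (z' - z))
   with (z' * (z' ^ S (S n) - z ^ S (S n) - RtoC (INR (S (S n))) * z ^ S n * (z' - z))
         + RtoC (INR (S (S n))) * z ^ S n * (z' - z) ^ 2).
  2: { rewrite (S_INR (S (S n))), RtoC_plus. simpl (_ ^ _). ring. }
  eapply Rle_trans; [apply Cmod_triangle|]. rewrite !Cmod_mult, !Cmod_pow, Cmod_R.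
  rewrite (Rabs_pos_eq (INR _)) by apply pos_INR.
  set (d := Cmod (z' - z)) in *.
  set (T := Cmod (z' ^ S (S n) - z ^ S (S n) - RtoC (INR (S (S n))) * z ^ S n * (z' - z))) in *.
  assert (0 <= rho)%R by lra.
  assert (Hp : (Cmod z ^ S n <= rho ^ S n)%R) by (apply pow_incr; lra).
  assert (Hrn : (0 <= rho ^ S n)%R) by (apply pow_le; lra).
  assert (B1 : (Cmod z' * T <= rho * (INR (S n) * INR (S (S n)) * rho ^ n * d ^ 2))%R).
  { apply Rmult_le_compat; auto. apply Cmod_ge_0. }
  replace (rho * (INR (S n) * INR (S (S n)) * rho ^ n * d ^ 2))%R with
    (INR (S n) * INR (S (S n)) * (rho ^ S n * d ^ 2))%R in B1 by (simpl; ring).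
  assert (B2 : (INR (S (S n)) * Cmod z ^ S n * d ^ 2 <= INR (S (S n)) * (rho ^ S n * d ^ 2))%R).
  { rewrite Rmult_assoc. apply Rmult_le_compat_l; [apply pos_INR|]. apply Rmult_le_compat_r; auto. }
  pose proof (pos_INR (S (S n))).
  assert (0 <= INR (S (S n)) * (rho ^ S n * d ^ 2))%R by (apply Rmult_le_pos; [|apply Rmult_le_pos]; auto).
  replace (INR (S (S n)) * INR (S (S (S n))) * rho ^ S n * d ^ 2)%R with
   (INR (S n) * INR (S (S n)) * (rho ^ S n * d ^ 2) + 2 * (INR (S (S n)) * (rho ^ S n * d ^ 2)))%R
   by (rewrite (S_INR (S (S n))), (S_INR (S n)); ring).
  lra.
Qed.

(** For partial sums the first-order error is at most [B |z' - z|^2], where [B] is the sum of the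
    twice differentiated series of moduli. As [B] does not depend on the number of terms, the bound
    survives the limit. *)
Lemma Cps_cderiv (a : nat -> C) (f : C -> C) : (forall z, inD z -> Cps a z (f z)) ->
  forall z, inD z -> cderiv f z (Cpsum (Cps_derive a) z).
Proof.
intros Hf z Hz. unfold inD in *.
assert (Ha : conv_D a) by (intros x Hx; exists (f x); now apply Hf).
pose proof (Cmod_ge_0 z).
(* A radius between [|z|] and 1 leaves room for [z'] and keeps the twice differentiated series
   convergent. *)
set (rho := ((Cmod z + 1) / 2)%R).
set (b := fun n => Cmod (a n)).
set (c := PS_derive (PS_derive b)).
assert (Hrho : (0 <= rho < 1)%R) by (unfold rho; lra).
assert (Hex : ex_series (fun n => c n * rho ^ n)%R).
{ apply ex_pseries_R. apply ex_pseries_derive. rewrite CV_radius_derive. now apply conv_D_radius. }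
assert (Hcpos : forall n, (0 <= c n * rho ^ n)%R).
{ intros n. apply Rmult_le_pos; [|apply pow_le; lra]. unfold c, PS_derive, b.
  repeat apply Rmult_le_pos; try apply pos_INR. apply Cmod_ge_0. }
destruct Hex as (B & HB).
assert (HBn : forall n, (sum_n (fun n => c n * rho ^ n) n <= B)%R).
{ apply is_lim_seq_incr_compare; [exact HB|]. intros n. rewrite sum_Sn. unfold plus; simpl.
  specialize (Hcpos (S n)). simpl in Hcpos. lra. }
assert (HB0 : (0 <= B)%R).
{ specialize (HBn O). rewrite sum_O in HBn. specialize (Hcpos O). lra. }
(* Index shift: [sum_n _ n] has [n + 1] terms and each differentiation drops one index, hence
   [n + 3] terms for [f] and [n + 2] for its derivative. *)
assert (Hpart : forall z', (Cmod z' <= rho)%R -> forall n,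
  (Cmod (Csum (fun k => a k * z' ^ k)%C (S (S (S n))) - Csum (fun k => a k * z ^ k)%C (S (S (S n)))
         - Csum (fun k => Cps_derive a k * z ^ k)%C (S (S n)) * (z' - z))
   <= sum_n (fun n => c n * rho ^ n) n * Cmod (z' - z) ^ 2)%R).
{ intros z' Hz'. assert (Hzr : (Cmod z <= rho)%R) by (unfold rho; lra).
  assert (Tn : forall n, (Cmod (a (S (S n)) * (z' ^ S (S n) - z ^ S (S n) - RtoC (INR (S (S n))) * z ^ S n * (z' - z)))
     <= c n * rho ^ n * Cmod (z' - z) ^ 2)%R).
  { intros n. rewrite Cmod_mult. unfold c, PS_derive, b.
    replace (INR (S n) * (INR (S (S n)) * Cmod (a (S (S n)))) * rho ^ n * Cmod (z' - z) ^ 2)%R with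
     (Cmod (a (S (S n))) * (INR (S n) * INR (S (S n)) * rho ^ n * Cmod (z' - z) ^ 2))%R by ring.
    apply Rmult_le_compat_l; [apply Cmod_ge_0|]. now apply Cpow_minus_bound. }
  induction n as [|n IH].
  - rewrite sum_O. eapply Rle_trans; [|apply Tn]. right. f_equal.
    unfold Cps_derive. simpl. ring.
  - rewrite sum_Sn. unfold plus; simpl (AbelianMonoid.plus _ _ _). 
    rewrite Rmult_plus_distr_r.
    eapply Rle_trans; [|apply Rplus_le_compat; [exact IH|apply (Tn (S n))]].
    eapply Rle_trans; [|apply Cmod_triangle]. right. f_equal.
    rewrite (Csum_last (fun k => a k * z' ^ k) (S (S (S n)))), (Csum_last (fun k => a k * z ^ k) (S (S (S n)))),
      (Csum_last (fun k => Cps_derive a k * z ^ k) (S (S n))).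
    unfold Cps_derive at 2. ring. }
set (f1 := Cpsum (Cps_derive a) z).
assert (Hf1 : Cps (Cps_derive a) z f1) by (apply Cpsum_spec; [now apply conv_D_derive|auto]).
assert (Hquad : forall z', (Cmod z' <= rho)%R ->
   (Cmod (f z' - f z - f1 * (z' - z)) <= B * Cmod (z' - z) ^ 2)%R).
{ intros z' Hz'. apply le_epsilon. intros e He.
  assert (S1 := Hf z' ltac:(lra)). assert (S2 := Hf z Hz).
  apply Cps_Cser in S1, S2. assert (S3 := proj1 (Cps_Cser _ _ _) Hf1).
  set (d := Cmod (z' - z)). assert (Hd : (0 <= d)%R) by apply Cmod_ge_0.
  destruct (S1 (e / 3)%R ltac:(lra)) as (N1 & HN1).
  destruct (S2 (e / 3)%R ltac:(lra)) as (N2 & HN2).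
  destruct (S3 (e / 3 / (d + 1))%R) as (N3 & HN3). { repeat apply Rdiv_lt_0_compat; lra. }
  set (n := (N1 + N2 + N3)%nat).
  specialize (HN1 (S (S (S n))) ltac:(lia)). specialize (HN2 (S (S (S n))) ltac:(lia)).
  specialize (HN3 (S (S n)) ltac:(lia)). specialize (Hpart z' Hz' n).
  set (A1 := Csum (fun k => a k * z' ^ k) (S (S (S n)))) in *.
  set (A2 := Csum (fun k => a k * z ^ k) (S (S (S n)))) in *.
  set (A3 := Csum (fun k => Cps_derive a k * z ^ k) (S (S n))) in *.
  replace (f z' - f z - f1 * (z' - z)) with
    ((A1 - A2 - A3 * (z' - z)) - (A1 - f z') + (A2 - f z) + (A3 - f1) * (z' - z)) by ring.
  assert (L3 : (Cmod ((A3 - f1) * (z' - z)) <= e / 3)%R).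
  { rewrite Cmod_mult. fold d.
    assert (Cmod (A3 - f1) * (d + 1) <= e / 3)%R.
    { left. apply Rmult_lt_reg_r with (/ (d + 1))%R; [apply Rinv_0_lt_compat; lra|].
      rewrite Rmult_assoc, Rinv_r, Rmult_1_r by lra. exact HN3. }
    pose proof (Cmod_ge_0 (A3 - f1)). nra. }
  eapply Rle_trans; [apply Cmod_triangle|].
  eapply Rle_trans; [apply Rplus_le_compat_r, Cmod_triangle|].
  eapply Rle_trans; [apply Rplus_le_compat_r, Rplus_le_compat_r, Cmod_triangle_minus|].
  assert (sum_n (fun n => c n * rho ^ n) n * d ^ 2 <= B * d ^ 2)%R.
  { apply Rmult_le_compat_r; [nra|apply HBn]. }
  unfold d in *. lra. }
apply cderiv_eps. intros e He.
exists (Rmin (rho - Cmod z) (e / (B + 1))). split.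
{ apply Rmin_pos; [unfold rho; lra|apply Rdiv_lt_0_compat; lra]. }
intros z' Hz'.
assert (Z1 := Rlt_le_trans _ _ _ Hz' (Rmin_l _ _)). assert (Z2 := Rlt_le_trans _ _ _ Hz' (Rmin_r _ _)).
pose proof (Cmod_triangle_inv z' z).
eapply Rle_trans; [apply Hquad; lra|].
assert (Cmod (z' - z) * (B + 1) <= e)%R.
{ left. apply Rmult_lt_reg_r with (/ (B + 1))%R; [apply Rinv_0_lt_compat; lra|].
  rewrite Rmult_assoc, Rinv_r, Rmult_1_r by lra. exact Z2. }
pose proof (Cmod_ge_0 (z' - z)). nra.
Qed.

Lemma Cpsum_cderiv (a : nat -> C) (z : C) : conv_D a -> inD z ->
  cderiv (Cpsum a) z (Cpsum (Cps_derive a) z).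
Proof. intros Ha. apply Cps_cderiv. intros x Hx. now apply Cpsum_spec. Qed.

Lemma Cpsum_tail (a : nat -> C) (z : C) : conv_D a -> inD z ->
  Cpsum a z = a O + z * Cpsum (fun n => a (S n)) z.
Proof.
intros Ha Hz. apply Cpsum_eq, Cps_cons. apply Cpsum_spec; [now apply conv_D_tail|auto].
Qed.

Lemma inD_0 : inD 0.
Proof. unfold inD. rewrite Cmod_0. lra. Qed.

Lemma Cpsum_bigO_0 (a : nat -> C) : conv_D a -> bigO 0 (Cpsum a).
Proof.
intros Ha. apply bigO_ccont. eapply cderiv_ccont. apply Cpsum_cderiv; [auto|apply inD_0].
Qed.

(** Removing the constant term leaves [z] times the series of the tail; that factor raises the order
    by one, so the induction runs over all sequences. *)
Lemma Cpsum_taylor (n : nat) : forall a : nat -> C, conv_D a ->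
  bigO n (fun z => Cpsum a z - Csum (fun k => a k * z ^ k) n).
Proof.
induction n as [|n IH]; intros a Ha.
- apply (bigO_ext 0 (Cpsum a)); [intros; simpl; ring|now apply Cpsum_bigO_0].
- apply (bigO_ext (S n) (fun z => z ^ 1 * (Cpsum (fun n => a (S n)) z - Csum (fun k => a (S k) * z ^ k) n))).
  + intros z Hz. rewrite (Cpsum_tail a z Ha) by (unfold inD; lra). rewrite Csum_S.
    rewrite (Csum_ext (fun k => a (S k) * z ^ S k) (fun k => z * (a (S k) * z ^ k))) by (intros; simpl; ring).
    rewrite Csum_scal. simpl (_ ^ _). ring.
  + apply (bigO_mult 1 n); [apply bigO_pow|]. apply (IH (fun n => a (S n))). now apply conv_D_tail.
Qed.

(** * Exponential and sine *)

Lemma Cexp_plus (z w : C) : Cexp (z + w) = Cexp z * Cexp w.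
Proof.
unfold Cexp. destruct z as [x y], w as [u v]. simpl.
rewrite exp_plus, cos_plus, sin_plus. apply injective_projections; simpl; ring.
Qed.

Lemma Cexp_0 : Cexp 0 = 1.
Proof. unfold Cexp. simpl. rewrite exp_0, cos_0, sin_0. apply injective_projections; simpl; ring. Qed.

Lemma Cmod_Cexp (z : C) : Cmod (Cexp z) = exp (Re z).
Proof.
unfold Cexp. rewrite Cmod_mult, Cmod_R, Rabs_pos_eq by (left; apply exp_pos).
replace (Cmod (cos (Im z) + Ci * sin (Im z))) with 1%R; [ring|].
unfold Cmod. simpl. rewrite <- sqrt_1 at 1. f_equal.
pose proof (sin2_cos2 (Im z)) as H. unfold Rsqr in H.
transitivity (sin (Im z) * sin (Im z) + cos (Im z) * cos (Im z))%R; [now symmetry|ring].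
Qed.

Lemma Cexp_ne_0 (z : C) : Cexp z <> 0.
Proof. apply Cmod_gt_0. rewrite Cmod_Cexp. apply exp_pos. Qed.

Lemma derivable_pt_lim_0_bound (f : R -> R) (d eps : R) : derivable_pt_lim f 0 d -> (0 < eps)%R ->
  exists del : R, (0 < del)%R /\ forall h, (Rabs h < del)%R ->
    (Rabs (f h - f 0 - d * h) <= eps * Rabs h)%R.
Proof.
intros H He. destruct (H eps He) as (del & Hd). exists del. split; [apply cond_pos|].
intros h Hh. destruct (Req_dec h 0) as [->|N].
- replace (f 0 - f 0 - d * 0)%R with 0%R by ring. rewrite Rabs_R0. lra.
- specialize (Hd h N Hh). rewrite Rplus_0_l in Hd.
  replace (f h - f 0 - d * h)%R with (((f h - f 0) / h - d) * h)%R by (field; auto).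
  rewrite Rabs_mult. apply Rmult_le_compat_r; [apply Rabs_pos|lra].
Qed.

Lemma cderiv_Cexp_0 : cderiv Cexp 0 1.
Proof.
apply cderiv_eps. intros eps He.
(* The three error terms below add up to [6 e |h|], and [e <= 1] keeps [|1 + x|] at most 2. *)
set (e := Rmin 1 (eps / 6)). assert (He0 : (0 < e)%R) by (apply Rmin_pos; lra).
assert (He1 : (e <= 1)%R) by apply Rmin_l. assert (He6 : (6 * e <= eps)%R).
{ pose proof (Rmin_r 1 (eps / 6)). fold e in H. lra. }
clearbody e.
destruct (derivable_pt_lim_0_bound exp 1 e derivable_pt_lim_exp_0 He0) as (d1 & Hd1 & H1).
destruct (derivable_pt_lim_0_bound cos _ e (derivable_pt_lim_cos 0) He0) as (d2 & Hd2 & H2).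
destruct (derivable_pt_lim_0_bound sin _ e (derivable_pt_lim_sin 0) He0) as (d3 & Hd3 & H3).
exists (Rmin e (Rmin d1 (Rmin d2 d3))). split; [repeat apply Rmin_pos; auto|].
intros h Hh. replace (h - 0) with h in * by ring. rewrite Cexp_0.
pose proof (Rmin_l e (Rmin d1 (Rmin d2 d3))). pose proof (Rmin_r e (Rmin d1 (Rmin d2 d3))).
pose proof (Rmin_l d1 (Rmin d2 d3)). pose proof (Rmin_r d1 (Rmin d2 d3)).
pose proof (Rmin_l d2 d3). pose proof (Rmin_r d2 d3).
pose proof (re_le_Cmod h) as Bx. pose proof (im_le_Cmod h) as By.
specialize (H1 (Re h) ltac:(lra)). specialize (H2 (Im h) ltac:(lra)). specialize (H3 (Im h) ltac:(lra)).
rewrite exp_0 in H1. rewrite cos_0, sin_0 in *.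
set (x := Re h) in *. set (y := Im h) in *.
assert (Eh : h = RtoC x + Ci * RtoC y).
{ unfold x, y. destruct h as [a b]. apply injective_projections; simpl; ring. }
set (U := cos y + Ci * sin y).
assert (HU : Cmod U = 1%R).
{ pose proof (Cmod_Cexp (Ci * y)) as E. unfold Cexp in E. simpl in E.
  replace (0 * y - 1 * 0)%R with 0%R in E by ring. replace (0 * 0 + 1 * y)%R with y in E by ring.
  rewrite exp_0, Cmult_1_l in E. exact E. }
(* With [U = exp(i y)], this splits off the errors of the real [exp], then of [cos] and [sin]; the
   product [i x y] is what the factor [1 + x] overcounts. *)
replace (Cexp h - 1 - 1 * h) with
  (RtoC (exp x - 1 - 1 * x) * U + (1 + x) * (RtoC (cos y - 1 - - 0 * y) + Ci * RtoC (sin y - 0 - 1 * y)) + Ci * (x * y)).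
2: { unfold Cexp. fold x y. rewrite Eh. unfold U. rewrite !RtoC_minus, !RtoC_mult, !RtoC_opp. ring. }
eapply Rle_trans; [apply Cmod_triangle|].
eapply Rle_trans; [apply Rplus_le_compat_r, Cmod_triangle|].
rewrite !Cmod_mult, Cmod_Ci, HU, !Cmod_R.
assert (T : (Cmod (RtoC (cos y - 1 - - 0 * y) + Ci * RtoC (sin y - 0 - 1 * y)) <= 2 * e * Cmod h)%R).
{ eapply Rle_trans; [apply Cmod_triangle|]. rewrite Cmod_mult, Cmod_Ci, !Cmod_R. nra. }
assert (T1 : (Cmod (1 + x) <= 2)%R).
{ eapply Rle_trans; [apply Cmod_triangle|]. rewrite Cmod_1, Cmod_R. lra. }
pose proof (Cmod_ge_0 (RtoC (cos y - 1 - - 0 * y) + Ci * RtoC (sin y - 0 - 1 * y))).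
pose proof (Cmod_ge_0 (1 + x)). pose proof (Rabs_pos x). pose proof (Rabs_pos y). pose proof (Cmod_ge_0 h).
assert (Rabs x * Rabs y <= e * Cmod h)%R by (apply Rmult_le_compat; lra).
assert (Cmod (1 + x) * Cmod (RtoC (cos y - 1 - - 0 * y) + Ci * RtoC (sin y - 0 - 1 * y)) <= 2 * (2 * e * Cmod h))%R
  by (apply Rmult_le_compat; lra).
nra.
Qed.

Lemma cderiv_Cexp (z : C) : cderiv Cexp z (Cexp z).
Proof.
apply (cderiv_ext_loc (fun x => Cexp z * Cexp (x - z)) _ _ _ 1); [lra| |].
- intros x _. rewrite <- Cexp_plus. f_equal. ring.
- eapply cderiv_val.
  + apply cderiv_scal. apply (cderiv_comp Cexp (fun x => x - z)).
    * replace (z - z) with (RtoC 0) by ring. apply cderiv_Cexp_0.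
    * apply cderiv_minus; [apply cderiv_id|apply cderiv_const].
  + ring.
Qed.

Lemma cderiv_Cexp_scal (c z : C) : cderiv (fun x => Cexp (c * x)) z (c * Cexp (c * z)).
Proof.
eapply cderiv_val.
- apply (cderiv_comp Cexp (fun x => c * x)); [apply cderiv_Cexp|]. apply cderiv_scal, cderiv_id.
- ring.
Qed.

Lemma INR_fact_ne_0 (n : nat) : RtoC (INR (fact n)) <> 0.
Proof. intros E. injection E. apply INR_fact_neq_0. Qed.

Lemma cderiv_exp_partial (n : nat) (z : C) :
  cderiv (fun x => Csum (fun k => x ^ k / INR (fact k))%C (S n)) z (Csum (fun k => z ^ k / INR (fact k))%C n).
Proof.
induction n as [|n IH].
- apply (cderiv_ext_loc (fun _ => 1) _ _ _ 1); [lra| |apply cderiv_const].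
  intros. simpl. field.
- apply (cderiv_plus (fun x => Csum (fun k => x ^ k / INR (fact k))%C (S n)) (fun x => x ^ S n / INR (fact (S n)))); auto.
  eapply cderiv_val.
  + apply cderiv_mult; [apply cderiv_pow, cderiv_id|apply cderiv_const].
  + cbv beta. simpl pred. rewrite fact_simpl, mult_INR, RtoC_mult. field.
    split; [apply INR_fact_ne_0|]. intros E. apply RtoC_inj in E. revert E. apply not_0_INR. lia.
Qed.

(** Each remainder is a primitive of the previous one and vanishes at 0, so [cderiv_bound_pow]
    raises the order by one and divides by [n + 1]. The constant 3 bounds the exponential on the
    unit disk. *)
Lemma Cexp_taylor (n : nat) : forall z : C, (Cmod z < 1)%R ->
  (Cmod (Cexp z - Csum (fun k => z ^ k / INR (fact k))%C n) <= 3 / INR (fact n) * Cmod z ^ n)%R.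
Proof.
induction n as [|n IH]; intros z Hz.
- simpl Csum. replace (Cexp z - 0) with (Cexp z) by ring. rewrite Cmod_Cexp. simpl.
  replace (3 / 1 * 1)%R with 3%R by field.
  eapply Rle_trans; [|apply exp_le_3]. left. apply exp_increasing.
  pose proof (re_le_Cmod z). pose proof (Rle_abs (Re z)). lra.
- set (F := fun x => Cexp x - Csum (fun k => x ^ k / INR (fact k))%C (S n)).
  assert (B := cderiv_bound_pow F (fun h => Cexp h - Csum (fun k => h ^ k / INR (fact k))%C n) 0 1 (3 / INR (fact n)) n).
  assert (F0 : F 0 = 0).
  { unfold F. rewrite Cexp_0, Csum_S.
    rewrite (Csum_ext _ (fun k => 0 * (RtoC 0 ^ k / INR (fact (S k))))).
    - rewrite Csum_scal. simpl. field.
    - intros k _. rewrite Cpow_S. field. apply INR_fact_ne_0. }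
  specialize (B ltac:(intros h Hh; replace (0 + h) with h by ring; apply cderiv_minus;
     [apply cderiv_Cexp|apply cderiv_exp_partial]) IH z Hz).
  rewrite F0 in B. replace (F (0 + z) - 0) with (F z) in B by (rewrite Cplus_0_l; ring).
  eapply Rle_trans; [exact B|]. right. rewrite fact_simpl, mult_INR. field.
  split; [apply INR_fact_neq_0|apply not_0_INR; lia].
Qed.

Definition Ccos (z : C) : C := (Cexp (Ci * z) + Cexp (- (Ci * z))) / 2.

Lemma Ci_sqr : Ci * Ci = - (1).
Proof. apply injective_projections; simpl; ring. Qed.

Lemma Ci_ne_0 : Ci <> 0.
Proof. apply Cmod_gt_0. rewrite Cmod_Ci. lra. Qed.

Lemma C2_ne_0 : RtoC 2 <> 0.
Proof. intros E. injection E. lra. Qed.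

Lemma cderiv_Cexp_opp_Ci (z : C) : cderiv (fun x => Cexp (- (Ci * x))) z (- Ci * Cexp (- (Ci * z))).
Proof.
apply (cderiv_ext_loc (fun x => Cexp (- Ci * x)) _ _ _ 1); [lra|intros; f_equal; ring|].
replace (- (Ci * z)) with (- Ci * z) by ring. apply cderiv_Cexp_scal.
Qed.

Lemma cderiv_Csin (z : C) : cderiv Csin z (Ccos z).
Proof.
eapply cderiv_val.
- apply cderiv_mult; [apply cderiv_minus; [apply cderiv_Cexp_scal|apply cderiv_Cexp_opp_Ci]|apply cderiv_const].
- unfold Ccos. cbv beta. field. apply Ci_ne_0.
Qed.

Lemma cderiv_Ccos (z : C) : cderiv Ccos z (- Csin z).
Proof.
eapply cderiv_val.
- apply cderiv_mult; [apply cderiv_plus; [apply cderiv_Cexp_scal|apply cderiv_Cexp_opp_Ci]|apply cderiv_const].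
- unfold Csin. cbv beta.
  transitivity ((Ci * Ci) * (Cexp (Ci * z) - Cexp (- (Ci * z))) / (2 * Ci)).
  + field. apply Ci_ne_0.
  + rewrite Ci_sqr. field. apply Ci_ne_0.
Qed.

(** Left in powers of [Ci], so that [Csin_taylor] is a linear combination of two exponential
    estimates without a parity split. *)
Definition sin_coef (k : nat) : C := (Ci ^ k - (- Ci) ^ k) / (2 * Ci) / INR (fact k).
Definition cos_coef (k : nat) : C := (Ci ^ k + (- Ci) ^ k) / 2 / INR (fact k).

Lemma Cmod_Ci_mult (z : C) : Cmod (Ci * z) = Cmod z.
Proof. rewrite Cmod_mult, Cmod_Ci. ring. Qed.

Lemma Csin_taylor (n : nat) (z : C) : (Cmod z < 1)%R ->
  (Cmod (Csin z - Csum (fun k => sin_coef k * z ^ k)%C n) <= 3 / INR (fact n) * Cmod z ^ n)%R.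
Proof.
intros Hz.
assert (P := Cexp_taylor n (Ci * z) ltac:(now rewrite Cmod_Ci_mult)).
assert (Q := Cexp_taylor n (- (Ci * z)) ltac:(now rewrite Cmod_opp, Cmod_Ci_mult)).
rewrite Cmod_opp in Q. rewrite Cmod_Ci_mult in P, Q.
set (A := Csum (fun k => (Ci * z) ^ k / INR (fact k)) n) in *.
set (B := Csum (fun k => (- (Ci * z)) ^ k / INR (fact k)) n) in *.
replace (Csin z - Csum (fun k => sin_coef k * z ^ k)%C n) with
  (((Cexp (Ci * z) - A) - (Cexp (- (Ci * z)) - B)) / (2 * Ci)).
- rewrite Cmod_div, Cmod_mult, Cmod_Ci, Cmod_R, Rabs_pos_eq
    by first [lra|apply Cmult_neq_0; [apply C2_ne_0|apply Ci_ne_0]].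
  pose proof (Cmod_triangle_minus (Cexp (Ci * z) - A) (Cexp (- (Ci * z)) - B)). lra.
- replace (Csum (fun k => sin_coef k * z ^ k)%C n) with (/ (2 * Ci) * (A + - (1) * B)).
  + unfold Csin. field. apply Ci_ne_0.
  + unfold A, B. rewrite <- Csum_scal, <- Csum_plus, <- Csum_scal. apply Csum_ext. intros k _.
    replace (- (Ci * z)) with ((- Ci) * z) by ring. rewrite !Cpow_mult_l. unfold sin_coef.
    field. split; [apply Ci_ne_0|apply INR_fact_ne_0].
Qed.

Lemma Ccos_taylor (n : nat) (z : C) : (Cmod z < 1)%R ->
  (Cmod (Ccos z - Csum (fun k => cos_coef k * z ^ k)%C n) <= 3 / INR (fact n) * Cmod z ^ n)%R.
Proof.
intros Hz.
assert (P := Cexp_taylor n (Ci * z) ltac:(now rewrite Cmod_Ci_mult)).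
assert (Q := Cexp_taylor n (- (Ci * z)) ltac:(now rewrite Cmod_opp, Cmod_Ci_mult)).
rewrite Cmod_opp in Q. rewrite Cmod_Ci_mult in P, Q.
set (A := Csum (fun k => (Ci * z) ^ k / INR (fact k)) n) in *.
set (B := Csum (fun k => (- (Ci * z)) ^ k / INR (fact k)) n) in *.
replace (Ccos z - Csum (fun k => cos_coef k * z ^ k)%C n) with
  (((Cexp (Ci * z) - A) + (Cexp (- (Ci * z)) - B)) / 2).
- rewrite Cmod_div, Cmod_R, Rabs_pos_eq by (try lra; apply C2_ne_0).
  pose proof (Cmod_triangle (Cexp (Ci * z) - A) (Cexp (- (Ci * z)) - B)). lra.
- replace (Csum (fun k => cos_coef k * z ^ k)%C n) with (/ 2 * (A + B)).
  + unfold Ccos. field.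
  + unfold A, B. rewrite <- Csum_plus, <- Csum_scal. apply Csum_ext. intros k _.
    replace (- (Ci * z)) with ((- Ci) * z) by ring. rewrite !Cpow_mult_l. unfold cos_coef.
    field. apply INR_fact_ne_0.
Qed.

Lemma Ci_pow_2 : Ci ^ 2 = - (1).
Proof. simpl. rewrite Cmult_1_r. apply Ci_sqr. Qed.

Lemma Ci_pow_SS (k : nat) : Ci ^ S (S k) = - Ci ^ k.
Proof. replace (S (S k)) with (2 + k)%nat by lia. rewrite Cpow_add_r, Ci_pow_2. ring. Qed.

Lemma opp_Ci_pow_SS (k : nat) : (- Ci) ^ S (S k) = - (- Ci) ^ k.
Proof.
replace (S (S k)) with (2 + k)%nat by lia. rewrite Cpow_add_r.
replace ((- Ci) ^ 2) with (Ci ^ 2) by (simpl; ring). rewrite Ci_pow_2. ring.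
Qed.

Lemma Csin_poly (z : C) :
  Csum (fun k => sin_coef k * z ^ k)%C 6 = z - z ^ 3 / 6 + z ^ 5 / 120.
Proof.
simpl Csum. unfold sin_coef. rewrite !Ci_pow_SS, !opp_Ci_pow_SS.
replace (INR (fact 3)) with 6%R by (simpl; ring). replace (INR (fact 5)) with 120%R by (simpl; ring).
replace (INR (fact 1)) with 1%R by (simpl; ring).
replace (INR (fact 2)) with 2%R by (simpl; ring). replace (INR (fact 4)) with 24%R by (simpl; ring).
replace (INR (fact 0)) with 1%R by (simpl; ring).
simpl. field. apply Ci_ne_0.
Qed.

Lemma Ccos_poly (z : C) :
  Csum (fun k => cos_coef k * z ^ k)%C 6 = 1 - z ^ 2 / 2 + z ^ 4 / 24.
Proof.
simpl Csum. unfold cos_coef. rewrite !Ci_pow_SS, !opp_Ci_pow_SS.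
replace (INR (fact 3)) with 6%R by (simpl; ring). replace (INR (fact 5)) with 120%R by (simpl; ring).
replace (INR (fact 1)) with 1%R by (simpl; ring).
replace (INR (fact 2)) with 2%R by (simpl; ring). replace (INR (fact 4)) with 24%R by (simpl; ring).
replace (INR (fact 0)) with 1%R by (simpl; ring).
simpl. field.
Qed.

(** This is [(1 - z)^2 xi'(z)], so [xi] is locally univalent on the disk. *)
Lemma xi_deriv_numerator_ne_0 (z : C) : inD z -> Ccos z * (1 - z) + Csin z <> 0.
Proof.
unfold inD. intros Hz.
assert (P := Csin_taylor 6 z Hz). assert (Q := Ccos_taylor 6 z Hz).
rewrite Csin_poly in P. rewrite Ccos_poly in Q.
set (r := Cmod z) in *. assert (Hr : (0 <= r)%R) by apply Cmod_ge_0.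
assert (Hp : forall n, (0 <= r ^ n <= 1)%R).
{ intros n. split; [now apply pow_le|]. rewrite <- (pow1 n). apply pow_incr. lra. }
assert (H6 : (3 / INR (fact 6) * r ^ 6 <= 1 / 240)%R).
{ replace (INR (fact 6)) with 720%R by (simpl; ring). pose proof (Hp 6%nat). lra. }
set (es := Csin z - (z - z ^ 3 / 6 + z ^ 5 / 120)) in *.
set (ec := Ccos z - (1 - z ^ 2 / 2 + z ^ 4 / 24)) in *.
(* This is [cos z (1 - z) + sin z = 1 - z^2/2 + z^3/3 + z^4/24 - z^5/30 + ...] solved for 1, with
   [ec] and [es] the Taylor errors. *)
assert (E : RtoC 1 = (Ccos z * (1 - z) + Csin z) + RtoC (1/2) * z ^ 2 - RtoC (1/3) * z ^ 3 - RtoC (1/24) * z ^ 4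
   + RtoC (1/30) * z ^ 5 - ec * (1 - z) - es).
{ unfold es, ec. rewrite !RtoC_div by lra. simpl. field. }
intros E0. rewrite E0 in E.
(* The moduli total only [221/240]; the error [ec] counts twice because [|1 - z| <= 2]. *)
assert (L : (Cmod 1 <= 1/2 + 1/3 + 1/24 + 1/30 + 2/240 + 1/240)%R); [|rewrite Cmod_1 in L; lra].
rewrite E.
pose proof (Hp 2%nat). pose proof (Hp 3%nat). pose proof (Hp 4%nat). pose proof (Hp 5%nat).
eapply Rle_trans; [apply Cmod_triangle_minus|]. apply Rplus_le_compat; [|lra].
eapply Rle_trans; [apply Cmod_triangle_minus|]. apply Rplus_le_compat.
2: { rewrite Cmod_mult. pose proof (Cmod_triangle_minus 1 z) as T. rewrite Cmod_1 in T. fold r in T.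
     pose proof (Cmod_ge_0 ec). pose proof (Cmod_ge_0 (1 - z)). nra. }
eapply Rle_trans; [apply Cmod_triangle|]. apply Rplus_le_compat.
2: { rewrite Cmod_mult, Cmod_pow, Cmod_R, Rabs_pos_eq by lra. fold r. lra. }
eapply Rle_trans; [apply Cmod_triangle_minus|]. apply Rplus_le_compat.
2: { rewrite Cmod_mult, Cmod_pow, Cmod_R, Rabs_pos_eq by lra. fold r. lra. }
eapply Rle_trans; [apply Cmod_triangle_minus|]. apply Rplus_le_compat.
2: { rewrite Cmod_mult, Cmod_pow, Cmod_R, Rabs_pos_eq by lra. fold r. lra. }
rewrite Cplus_0_l. rewrite Cmod_mult, Cmod_pow, Cmod_R, Rabs_pos_eq by lra. fold r. lra.
Qed.

(** * The upper bound *)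

Lemma inD_one_minus_ne_0 (z : C) : inD z -> 1 - z <> 0.
Proof.
unfold inD. intros Hz E. apply Cminus_eq_0 in E. rewrite <- E, Cmod_1 in Hz. lra.
Qed.

(** Differentiating the equation expresses [w'] through [f], [f'], [f''] and [w]
    alone, hence [w'] is itself differentiable. *)
Lemma xi_equation_hol2 (f f1 f2 w : C -> C) :
  (forall z, (0 < Cmod z < 1)%R -> cderiv f z (f1 z) /\ cderiv f1 z (f2 z) /\ cdiff f2 z /\
     f z <> 0 /\ inD (w z) /\ cdiff w z /\
     (1 - w z) * (z * f1 z - f z) = f z * Csin (w z)) ->
  hol2 w.
Proof.
intros H.
(* Differentiation gives [w' (f cos w + z f' - f) = (1 - w) z f'' - f' sin w]. Multiplying by
   [1 - w] and using the equation once more turns the left factor into [f] times the numerator of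
   [xi']. *)
exists (fun z => (1 - w z) * ((1 - w z) * (z * f2 z) - f1 z * Csin (w z)) /
                 (f z * (Ccos (w z) * (1 - w z) + Csin (w z)))).
intros z Hz. destruct (H z Hz) as (Hf & Hf1 & (f3 & Hf2) & Hnz & Hw & (d & Hd) & Heq).
assert (Hdn : f z * (Ccos (w z) * (1 - w z) + Csin (w z)) <> 0).
{ apply Cmult_neq_0; auto. now apply xi_deriv_numerator_ne_0. }
assert (Hone : cderiv (fun z => 1 - w z) z (0 - d)).
{ apply cderiv_minus; [apply cderiv_const|auto]. }
assert (Hsin : cderiv (fun z => Csin (w z)) z (Ccos (w z) * d)).
{ apply (cderiv_comp Csin w); [apply cderiv_Csin|auto]. }
assert (Hcos : cderiv (fun z => Ccos (w z)) z (- Csin (w z) * d)).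
{ apply (cderiv_comp Ccos w); [apply cderiv_Ccos|auto]. }
assert (HL : cderiv (fun z => (1 - w z) * (z * f1 z - f z)) z
   ((0 - d) * (z * f1 z - f z) + (1 - w z) * ((1 * f1 z + z * f2 z) - f1 z))).
{ apply (cderiv_mult (fun z => 1 - w z) (fun z => z * f1 z - f z)); auto.
  apply (cderiv_minus (fun z => z * f1 z)); auto.
  apply (cderiv_mult (fun z => z)); auto. apply cderiv_id. }
(* The same function differentiated through the right side of the equation. That equation is known
   on the punctured disk, hence the radius chosen below. *)
assert (HR : cderiv (fun z => (1 - w z) * (z * f1 z - f z)) z (f1 z * Csin (w z) + f z * (Ccos (w z) * d))).
{ apply (cderiv_ext_loc (fun z => f z * Csin (w z)) _ _ _ (Rmin (Cmod z) (1 - Cmod z))).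
  - apply Rmin_pos; lra.
  - intros z' Hz'.
    assert (Z1 := Rlt_le_trans _ _ _ Hz' (Rmin_l _ _)). assert (Z2 := Rlt_le_trans _ _ _ Hz' (Rmin_r _ _)).
    pose proof (Cmod_triangle_inv z' z). pose proof (Cmod_triangle_inv z z') as T.
    rewrite Cmod_minus_sym in T.
    destruct (H z' ltac:(lra)) as (_ & _ & _ & _ & _ & _ & E). now symmetry.
  - apply (cderiv_mult f (fun z => Csin (w z))); auto. }
assert (Hu := cderiv_unique _ _ _ _ HL HR).
split.
- eapply cderiv_val; [exact Hd|].
  assert (K : d * (f z * (Ccos (w z) * (1 - w z) + Csin (w z)))
    = (1 - w z) * ((1 - w z) * (z * f2 z) - f1 z * Csin (w z))).
  { apply Cminus_eq_0.
    transitivity (d * (f z * Csin (w z) - (1 - w z) * (z * f1 z - f z)) +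
       (1 - w z) * ((f1 z * Csin (w z) + f z * (Ccos (w z) * d)) -
         ((0 - d) * (z * f1 z - f z) + (1 - w z) * (1 * f1 z + z * f2 z - f1 z)))); [ring|].
    rewrite Hu, Heq. ring. }
  rewrite <- K. field.
  split; intros E; apply Hdn; rewrite E; ring.
- eexists. apply cderiv_div; auto.
  + apply (cderiv_mult (fun z => 1 - w z) (fun z => (1 - w z) * (z * f2 z) - f1 z * Csin (w z))); [exact Hone|].
    apply (cderiv_minus (fun z => (1 - w z) * (z * f2 z)) (fun z => f1 z * Csin (w z))).
    * apply (cderiv_mult (fun z => 1 - w z) (fun z => z * f2 z)); [exact Hone|].
      apply (cderiv_mult (fun z => z)); [apply cderiv_id|exact Hf2].
    * apply (cderiv_mult f1 (fun z => Csin (w z))); [exact Hf1|exact Hsin].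
  + apply (cderiv_mult f (fun z => Ccos (w z) * (1 - w z) + Csin (w z))); [exact Hf|].
    apply (cderiv_plus (fun z => Ccos (w z) * (1 - w z)) (fun z => Csin (w z))); [|exact Hsin].
    apply (cderiv_mult (fun z => Ccos (w z)) (fun z => 1 - w z)); [exact Hcos|exact Hone].
Qed.

Lemma cdiff_bigO_1 (w : C -> C) : cdiff w 0 -> w 0 = 0 -> bigO 1 w.
Proof.
intros (d & phi & Hc & _ & H) H0.
apply (bigO_ext 1 (fun z => phi z * z ^ 1)).
- intros z _. rewrite (H z), H0. simpl. ring.
- apply (bigO_mult 0 1); [now apply bigO_ccont|apply bigO_pow].
Qed.

Lemma Csin_cubic_bigO (w : C -> C) : bigO 1 w -> (forall z, (0 < Cmod z < 1)%R -> inD (w z)) ->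
  bigO 4 (fun z => Csin (w z) - w z + w z ^ 3 / 6).
Proof.
intros Hw Hd.
assert (Hp : forall n, bigO n (fun z => w z ^ n)).
{ induction n as [|n IH]; [exact (bigO_const 1)|]. exact (bigO_mult 1 n w (fun z => w z ^ n) Hw IH). }
apply (bigO_ext 4 (fun z => (Csin (w z) - Csum (fun k => sin_coef k * w z ^ k) 6) + / 120 * w z ^ 5)).
{ intros z _. rewrite Csin_poly. field. }
apply bigO_plus; [|apply bigO_scal, (bigO_le 4 5); auto].
apply (bigO_le 4 6); [lia|].
destruct (Hp 6%nat) as (K & del & HK & Hdel & H).
exists (3 / INR (fact 6) * K)%R, (Rmin del 1).
assert (H6 : (0 < 3 / INR (fact 6))%R) by (apply Rdiv_lt_0_compat; [lra|apply INR_fact_lt_0]).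
repeat split; [nra|apply Rmin_pos; lra|].
intros z [Hz1 Hz2].
assert (Z1 := Rlt_le_trans _ _ _ Hz2 (Rmin_l _ _)). assert (Z2 := Rlt_le_trans _ _ _ Hz2 (Rmin_r _ _)).
eapply Rle_trans; [apply Csin_taylor; apply Hd; lra|].
specialize (H z ltac:(lra)). rewrite Cmod_pow in H. rewrite Rmult_assoc. apply Rmult_le_compat_l; lra.
Qed.

(** Two passes through the equation: the first gives [w = a2 z + O(z^2)], which fixes [w^3] up to
    [O(z^4)]; the second then yields all three coefficients. *)
Lemma schwarz_expansion (a : nat -> C) (w : C -> C) (c1 c2 c3 : C) :
  conv_D a -> a 1%nat = 1 -> bigO 1 w -> (forall z, (0 < Cmod z < 1)%R -> inD (w z)) ->
  (forall z, (0 < Cmod z < 1)%R ->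
     (1 - w z) * (Cpsum (Cps_derive a) z - Cpsum (fun n => a (S n)) z)
       = Cpsum (fun n => a (S n)) z * Csin (w z)) ->
  c1 = a 2%nat -> c2 = 2 * a 3%nat - 2 * a 2%nat ^ 2 ->
  c3 = 3 * a 4%nat + a 2%nat ^ 3 / 6 - 2 * a 2%nat * c2 - 3 * a 3%nat * a 2%nat ->
  bigO 4 (fun z => w z - c1 * z - c2 * z ^ 2 - c3 * z ^ 3).
Proof.
intros Ha Ha1 Hw Hd Heq E1 E2 E3.
set (F := Cpsum (fun n => a (S n))) in *. set (f1 := Cpsum (Cps_derive a)) in *.
assert (HFd : forall n, bigO n (fun z => F z - Csum (fun k => a (S k) * z ^ k) n)).
{ intros n. apply (Cpsum_taylor n (fun n => a (S n))). now apply conv_D_tail. }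
assert (Hf1d : forall n, bigO n (fun z => f1 z - Csum (fun k => Cps_derive a k * z ^ k) n)).
{ intros n. apply Cpsum_taylor. now apply conv_D_derive. }
assert (R2 : RtoC (INR 2) = 2) by (f_equal; simpl; ring).
assert (R3 : RtoC (INR 3) = 3) by (f_equal; simpl; ring).
assert (R4 : RtoC (INR 4) = 4) by (f_equal; simpl; ring).
assert (HF1 : bigO 1 (fun z => F z - 1)).
{ eapply bigO_ext; [|apply (HFd 1%nat)]. intros. simpl. rewrite Ha1. ring. }
assert (HF2 : bigO 2 (fun z => F z - 1 - a 2%nat * z)).
{ eapply bigO_ext; [|apply (HFd 2%nat)]. intros. simpl. rewrite Ha1. ring. }
assert (HF4 : bigO 4 (fun z => F z - 1 - a 2%nat * z - a 3%nat * z ^ 2 - a 4%nat * z ^ 3)).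
{ eapply bigO_ext; [|apply (HFd 4%nat)]. intros. simpl. rewrite Ha1. ring. }
assert (Hf11 : bigO 1 (fun z => f1 z - 1)).
{ eapply bigO_ext; [|apply (Hf1d 1%nat)]. intros. unfold Cps_derive. simpl. rewrite Ha1. ring. }
assert (Hf12 : bigO 2 (fun z => f1 z - 1 - 2 * a 2%nat * z)).
{ eapply bigO_ext; [|apply (Hf1d 2%nat)]. intros. cbn [Csum]. unfold Cps_derive. rewrite R2, Ha1. simpl. ring. }
assert (Hf14 : bigO 4 (fun z => f1 z - 1 - 2 * a 2%nat * z - 3 * a 3%nat * z ^ 2 - 4 * a 4%nat * z ^ 3)).
{ eapply bigO_ext; [|apply (Hf1d 4%nat)]. intros. cbn [Csum]. unfold Cps_derive. rewrite R2, R3, R4, Ha1. simpl. ring. }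
assert (Hinv : bigO 0 (fun z => / f1 z)).
{ apply bigO_inv with (RtoC 1); auto. intros E; injection E; lra. }
assert (F0 : bigO 0 F).
{ eapply bigO_ext; [|apply (HFd 0%nat)]. intros. simpl. ring. }
assert (Hsin := Csin_cubic_bigO w Hw Hd).
assert (Hw2 : bigO 2 (fun z => w z ^ 2)).
{ eapply bigO_ext; [|exact (bigO_mult 1 1 w w Hw Hw)]. intros. simpl. ring. }
assert (Hw3 : bigO 3 (fun z => w z ^ 3)).
{ exact (bigO_mult 1 2 w (fun z => w z ^ 2) Hw Hw2). }
assert (Hmain : forall z, (0 < Cmod z < 1)%R ->
  w z * f1 z = (f1 z - F z) + F z * (w z ^ 3 / 6) - F z * (Csin (w z) - w z + w z ^ 3 / 6)).
{ intros z Hz. specialize (Heq z Hz). apply Cminus_eq_0.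
  transitivity (- ((1 - w z) * (f1 z - F z)) + F z * Csin (w z)); [field|rewrite Heq; ring]. }
assert (Hfnz : exists r, (0 < r)%R /\ forall z, (0 < Cmod z < r)%R -> f1 z <> 0).
{ destruct (bigO_lt _ 1 Hf11 ltac:(lra)) as (r & Hr & H). exists r. split; auto.
  intros z Hz E. specialize (H z Hz). rewrite E in H.
  replace (0 - 1) with (- (1)) in H by ring. rewrite Cmod_opp, Cmod_1 in H. lra. }
(* As [f1] tends to 1, orders at 0 may be tested after multiplication by [f1], and [Hmain] expresses
   [w f1] through known expansions. *)
assert (Hdiv : forall n g, bigO n (fun z => g z * f1 z) -> bigO n g).
{ intros n g Hg. destruct Hfnz as (r & Hr & Hnz).
  apply (bigO_ext_loc n (fun z => (g z * f1 z) * / f1 z) _ r); auto.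
  - intros z Hz. field. auto.
  - replace n with (n + 0)%nat by lia. apply (bigO_mult n 0); auto. }
assert (S1 : bigO 2 (fun z => w z - a 2%nat * z)).
{ apply Hdiv.
  apply (bigO_ext 2 (fun z => ((f1 z - 1 - 2 * a 2%nat * z) - (F z - 1 - a 2%nat * z))
     - a 2%nat * (z ^ 1 * (f1 z - 1)) + F z * (/ 6 * w z ^ 3) - F z * (Csin (w z) - w z + w z ^ 3 / 6))).
  - intros z Hz. replace ((w z - a 2%nat * z) * f1 z) with (w z * f1 z - a 2%nat * z * f1 z) by ring.
    rewrite (Hmain z Hz). simpl. field.
  - apply bigO_minus; [apply bigO_plus; [apply bigO_minus; [apply bigO_minus|]|]|]; auto.
    + apply bigO_scal. apply (bigO_mult 1 1); [apply bigO_pow|auto].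
    + apply (bigO_le 2 3); [lia|]. apply (bigO_mult 0 3); [auto|now apply bigO_scal].
    + apply (bigO_le 2 4); [lia|]. apply (bigO_mult 0 4); auto. }
(* In the difference of cubes, the factor [w - a2 z] and the quadratic cofactor each have order
   2. *)
assert (S3 : bigO 4 (fun z => w z ^ 3 - a 2%nat ^ 3 * z ^ 3)).
{ apply (bigO_ext 4 (fun z => (w z - a 2%nat * z) * (w z ^ 2 + a 2%nat * (w z * z ^ 1) + a 2%nat ^ 2 * z ^ 2))).
  - intros. simpl. ring.
  - apply (bigO_mult 2 2); auto. apply bigO_plus; [apply bigO_plus|]; auto.
    + apply bigO_scal. apply (bigO_mult 1 1); [auto|apply bigO_pow].
    + apply bigO_mono; auto. }
apply Hdiv.
(* The choice of [c1, c2, c3] cancels every degree up to 3; the last three monomials are what the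
   product of the two polynomials leaves in degrees 4 to 6. *)
apply (bigO_ext 4 (fun z =>
   (f1 z - 1 - 2 * a 2%nat * z - 3 * a 3%nat * z ^ 2 - 4 * a 4%nat * z ^ 3)
     * (1 - c1 * z ^ 1 - c2 * z ^ 2 - c3 * z ^ 3)
   - (F z - 1 - a 2%nat * z - a 3%nat * z ^ 2 - a 4%nat * z ^ 3)
   + F z * (/ 6 * (w z ^ 3 - a 2%nat ^ 3 * z ^ 3))
   + (F z - 1) * (a 2%nat ^ 3 / 6 * z ^ 3)
   - F z * (Csin (w z) - w z + w z ^ 3 / 6)
   + (- (4 * a 4%nat * c1 + 3 * a 3%nat * c2 + 2 * a 2%nat * c3)) * z ^ 4
   + (- (4 * a 4%nat * c2 + 3 * a 3%nat * c3)) * z ^ 5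
   + (- (4 * a 4%nat * c3)) * z ^ 6)).
- intros z Hz.
  replace ((w z - c1 * z - c2 * z ^ 2 - c3 * z ^ 3) * f1 z) with
    (w z * f1 z - (c1 * z + c2 * z ^ 2 + c3 * z ^ 3) * f1 z) by ring.
  rewrite (Hmain z Hz). rewrite E3, E2, E1. simpl. field.
- do 3 (apply bigO_plus; [|apply bigO_mono; lia]).
  apply bigO_minus; [apply bigO_plus; [apply bigO_plus; [apply bigO_minus|]|]|]; auto.
  + apply (bigO_mult 4 0); auto.
    repeat apply bigO_minus; try (apply bigO_mono; lia). apply bigO_const.
  + apply (bigO_mult 0 4); [auto|now apply bigO_scal].
  + apply (bigO_mult 1 3); [auto|apply bigO_mono; auto].
  + apply (bigO_mult 0 4); auto.
Qed.

Lemma hankel_bound (f : C -> C) (a : nat -> C) : in_S_xi f a -> (Cmod (H22 a) <= / 4)%R.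
Proof.
intros ((Ha0 & Ha1 & Hf) & w & Hholo & Hw0 & HwD & Hsub).
assert (Ha : conv_D a) by (intros z Hz; exists (f z); now apply Hf).
set (f1 := Cpsum (Cps_derive a)). set (F := Cpsum (fun n => a (S n))).
assert (Hfd : forall z, inD z -> cderiv f z (f1 z)) by (intros; now apply Cps_cderiv).
assert (Hcd : forall z, inD z -> cdiff w z).
{ intros z Hz. destruct (Hholo z Hz) as (d & Hd). exists d. now apply cderiv_is_derive. }
assert (HwD' : forall z, (0 < Cmod z < 1)%R -> inD (w z)) by (intros z Hz; apply HwD; unfold inD; lra).
assert (Hnz : forall z, (0 < Cmod z < 1)%R -> z <> 0) by (intros z Hz; apply Cmod_gt_0; lra).
assert (Heq : forall z, (0 < Cmod z < 1)%R -> f z <> 0 /\ (1 - w z) * (z * f1 z - f z) = f z * Csin (w z)).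
{ intros z Hz. assert (HzD : inD z) by (unfold inD; lra).
  destruct (Hsub z HzD (Hnz z Hz)) as (Hfz & d & Hd & He). split; auto.
  assert (Ed : d = f1 z).
  { apply (cderiv_unique f z); [now apply cderiv_is_derive|auto]. }
  rewrite Ed in He. unfold xi in He.
  assert (H1 : 1 - w z <> 0) by (apply inD_one_minus_ne_0; auto).
  replace (z * f1 z - f z) with ((z * f1 z / f z - 1) * f z) by (field; auto).
  rewrite He. field; auto. }
assert (Hw : hol2 w).
{ apply (xi_equation_hol2 f f1 (Cpsum (Cps_derive (Cps_derive a)))).
  intros z Hz. assert (HzD : inD z) by (unfold inD; lra). destruct (Heq z Hz) as [Hfz He].
  repeat split; auto.
  - apply Cpsum_cderiv; auto. now apply conv_D_derive.
  - eexists. apply Cpsum_cderiv; auto. now repeat apply conv_D_derive. }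
assert (Hw1 : bigO 1 w) by (apply cdiff_bigO_1; auto; apply Hcd, inD_0).
(* The equation is divided by [z], using [f = z F], which holds because [a 0 = 0]. *)
assert (HO := schwarz_expansion a w _ _ _ Ha Ha1 Hw1 HwD'
   ltac:(intros z Hz; destruct (Heq z Hz) as [Hfz He];
     assert (Ef : f z = z * F z) by
       (rewrite <- (Cpsum_eq a z (f z)) by (apply Hf; unfold inD; lra);
        rewrite Cpsum_tail by (auto; unfold inD; lra); rewrite Ha0; unfold F; ring);
     rewrite Ef in He; fold f1 F;
     transitivity ((1 - w z) * (z * f1 z - z * F z) / z); [field; now apply Hnz|];
     rewrite He; field; now apply Hnz) eq_refl eq_refl eq_refl).
set (c1 := a 2%nat) in *. set (c2 := 2 * a 3%nat - 2 * c1 ^ 2) in *.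
set (c3 := 3 * a 4%nat + c1 ^ 3 / 6 - 2 * c1 * c2 - 3 * a 3%nat * c1) in *.
assert (Hpsi : hol2 (fun z => w z / z)) by (apply (hol2_div w (fun z => z)); auto; apply hol2_id).
(* Schwarz's lemma for [w]; the bound of [w/z] near 0 comes from differentiability of [w] there. *)
assert (Hpsi1 : forall z, (0 < Cmod z < 1)%R -> (Cmod (w z / z) <= 1)%R).
{ destruct (bigO_div_id 0 w Hw1) as (K & del & _ & Hdel & HK).
  apply max_principle_disk with del K; auto.
  - intros z Hz. specialize (HK z Hz). now rewrite pow_O, Rmult_1_r in HK.
  - intros z Hz. rewrite <- Cmod_mult. replace (z * (w z / z)) with (w z) by (field; auto).
    left. now apply HwD'. }
assert (B := hankel_schwarz_bound (fun z => w z / z) c1 c2 c3 Hpsi Hpsi1).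
replace (H22 a) with (c1 * c3 / 3 + c1 ^ 2 * c2 / 6 - c1 ^ 4 / 18 - c2 ^ 2 / 4).
- apply B.
  apply (bigO_ext 3 (fun z => (w z - c1 * z - c2 * z ^ 2 - c3 * z ^ 3) / z)); [|now apply bigO_div_id].
  intros z Hz. simpl. field. auto.
- unfold H22, c3, c2, c1. field.
Qed.

(** * The extremal function *)

Lemma conv_D_bounded (a : nat -> C) (M : R) : (forall n, (Cmod (a n) <= M)%R) -> conv_D a.
Proof.
intros H. apply conv_D_le with (fun _ => M); auto. intros r Hr.
apply ex_pseries_R. apply (ex_series_scal_l M (fun n => r ^ n)%R).
exists (/ (1 - r))%R. apply is_series_geom. rewrite Rabs_pos_eq; lra.
Qed.

Lemma Cmod_Csum_le (u : nat -> C) (M : R) (n : nat) :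
  (forall k, (k < n)%nat -> (Cmod (u k) <= M)%R) -> (Cmod (Csum u n) <= INR n * M)%R.
Proof.
induction n as [|n IH]; intros H.
- simpl. rewrite Cmod_0. lra.
- rewrite Csum_last, S_INR. eapply Rle_trans; [apply Cmod_triangle|].
  specialize (H n ltac:(lia)) as Hn. specialize (IH ltac:(intros; apply H; lia)). lra.
Qed.

(** * Cauchy products of complex series *)

Lemma Cser_re_im (u : nat -> C) (l : C) :
  Cser u l <-> is_series (fun n => Re (u n)) (Re l) /\ is_series (fun n => Im (u n)) (Im l).
Proof.
assert (HRe : forall n, sum_n (fun n => Re (u n)) n = Re (Csum u (S n))).
{ induction n as [|n IH]; [rewrite sum_O; cbn [Csum]; now rewrite Cplus_0_l|]. rewrite sum_Sn, IH. reflexivity. }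
assert (HIm : forall n, sum_n (fun n => Im (u n)) n = Im (Csum u (S n))).
{ induction n as [|n IH]; [rewrite sum_O; cbn [Csum]; now rewrite Cplus_0_l|]. rewrite sum_Sn, IH. reflexivity. }
split.
- intros H. split; [change (is_lim_seq (sum_n (fun n => Re (u n))) (Re l))|change (is_lim_seq (sum_n (fun n => Im (u n))) (Im l))];
    apply is_lim_seq_spec; intros e; destruct (H e (cond_pos e)) as (N & HN); exists N;
    intros n Hn; specialize (HN (S n) ltac:(lia)); eapply Rle_lt_trans; try exact HN.
  + rewrite HRe. exact (re_le_Cmod (Csum u (S n) - l)).
  + rewrite HIm. exact (im_le_Cmod (Csum u (S n) - l)).
- intros [H1 H2] e He.
  change (is_lim_seq (sum_n (fun n => Re (u n))) (Re l)) in H1.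
  change (is_lim_seq (sum_n (fun n => Im (u n))) (Im l)) in H2.
  apply is_lim_seq_spec in H1, H2.
  destruct (H1 (mkposreal (e/2) ltac:(lra))) as (N1 & HN1).
  destruct (H2 (mkposreal (e/2) ltac:(lra))) as (N2 & HN2).
  exists (S (N1 + N2)). intros [|n] Hn; [lia|].
  specialize (HN1 n ltac:(lia)). specialize (HN2 n ltac:(lia)). rewrite HRe in HN1. rewrite HIm in HN2.
  simpl in HN1, HN2.
  eapply Rle_lt_trans; [apply Cmod_le_re_im|].
  change (Rabs (Re (Csum u (S n)) - Re l) + Rabs (Im (Csum u (S n)) - Im l) < e)%R. simpl in *. lra.
Qed.

Definition Cconv (u v : nat -> C) (n : nat) : C := Csum (fun j => u j * v (n - j)%nat) (S n).

Lemma Re_Csum (u : nat -> C) (n : nat) : Re (Csum u (S n)) = sum_f_R0 (fun k => Re (u k)) n.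
Proof.
induction n as [|n IH]; [cbn [Csum sum_f_R0]; now rewrite Cplus_0_l|]. rewrite tech5, <- IH. reflexivity.
Qed.

Lemma Im_Csum (u : nat -> C) (n : nat) : Im (Csum u (S n)) = sum_f_R0 (fun k => Im (u k)) n.
Proof.
induction n as [|n IH]; [cbn [Csum sum_f_R0]; now rewrite Cplus_0_l|]. rewrite tech5, <- IH. reflexivity.
Qed.

(** Real and imaginary parts reduce the Cauchy product to four real ones with absolutely convergent
    factors. *)
Lemma Cser_mult (u v : nat -> C) (U V : C) : Cser u U -> Cser v V ->
  ex_series (fun n => Cmod (u n)) -> ex_series (fun n => Cmod (v n)) ->
  Cser (Cconv u v) (U * V).
Proof.
intros Hu Hv Au Av. apply Cser_re_im in Hu, Hv. destruct Hu as [Ur Ui], Hv as [Vr Vi].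
assert (ARe : forall w, ex_series (fun n => Cmod (w n)) -> ex_series (fun n => Rabs (Re (w n)))).
{ intros w Hw. apply (@ex_series_le R_AbsRing R_CompleteNormedModule _ (fun n => Cmod (w n))); auto.
  intros n. change (Rabs (Rabs (Re (w n))) <= Cmod (w n))%R. rewrite Rabs_Rabsolu. apply re_le_Cmod. }
assert (AIm : forall w, ex_series (fun n => Cmod (w n)) -> ex_series (fun n => Rabs (Im (w n)))).
{ intros w Hw. apply (@ex_series_le R_AbsRing R_CompleteNormedModule _ (fun n => Cmod (w n))); auto.
  intros n. change (Rabs (Rabs (Im (w n))) <= Cmod (w n))%R. rewrite Rabs_Rabsolu. apply im_le_Cmod. }
assert (RR := is_series_mult _ _ _ _ Ur Vr (ARe u Au) (ARe v Av)).
assert (II := is_series_mult _ _ _ _ Ui Vi (AIm u Au) (AIm v Av)).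
assert (RI := is_series_mult _ _ _ _ Ur Vi (ARe u Au) (AIm v Av)).
assert (IR := is_series_mult _ _ _ _ Ui Vr (AIm u Au) (ARe v Av)).
apply Cser_re_im. split.
- apply (is_series_ext (fun n => (sum_f_R0 (fun k => Re (u k) * Re (v (n - k)%nat)) n
     - sum_f_R0 (fun k => Im (u k) * Im (v (n - k)%nat)) n)%R)).
  + intros n. unfold Cconv. rewrite Re_Csum, <- minus_sum. apply sum_eq. reflexivity.
  + exact (is_series_minus _ _ _ _ RR II).
- apply (is_series_ext (fun n => (sum_f_R0 (fun k => Re (u k) * Im (v (n - k)%nat)) n
     + sum_f_R0 (fun k => Im (u k) * Re (v (n - k)%nat)) n)%R)).
  + intros n. unfold Cconv. rewrite Im_Csum, <- sum_plus. apply sum_eq. reflexivity.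
  + exact (is_series_plus _ _ _ _ RI IR).
Qed.

Lemma Cpsum_mult (a b : nat -> C) (z : C) : conv_D a -> conv_D b -> inD z ->
  Cps (Cconv a b) z (Cpsum a z * Cpsum b z).
Proof.
intros Ha Hb Hz.
assert (Abs : forall c, conv_D c -> ex_series (fun n => Cmod (c n * z ^ n))).
{ intros c Hc. pose proof (Cmod_ge_0 z). unfold inD in Hz.
  assert (E := CV_disk_inside _ _ (conv_D_radius c (Cmod z) Hc ltac:(lra))).
  eapply ex_series_ext; [|exact E]. intros n. cbv beta. rewrite Cmod_mult, Cmod_pow.
  apply Rabs_pos_eq. apply Rmult_le_pos; [apply Cmod_ge_0|now apply pow_le]. }
apply Cps_Cser.
apply (Cser_ext (Cconv (fun n => a n * z ^ n) (fun n => b n * z ^ n))).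
- intros n. unfold Cconv. rewrite (Cmult_comm (Csum _ _)), <- Csum_scal. apply Csum_ext. intros k Hk.
  replace (z ^ n) with (z ^ (k + (n - k))) by (f_equal; lia). rewrite Cpow_add_r. ring.
- apply Cser_mult; auto; apply Cps_Cser, Cpsum_spec; auto.
Qed.

(** * Power series of sine and of xi *)

Lemma Csin_series (u : C) : inD u -> Cps sin_coef u (Csin u).
Proof.
intros Hu. apply Cps_Cser. intros e He. pose proof (Cmod_ge_0 u). unfold inD in Hu.
destruct (pow_lt_1_zero (Cmod u)) with (y := (e / 3)%R) as (N & HN); [rewrite Rabs_pos_eq; lra|lra|].
exists N. intros n Hn. specialize (HN n Hn). rewrite Rabs_pos_eq in HN by now apply pow_le.
rewrite Cmod_minus_sym. eapply Rle_lt_trans; [now apply Csin_taylor|].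
assert (F1 : (1 <= INR (fact n))%R) by (apply (le_INR 1); apply lt_O_fact).
apply Rle_lt_trans with (3 * Cmod u ^ n)%R; [|lra].
apply Rmult_le_compat_r; [now apply pow_le|].
unfold Rdiv. rewrite <- (Rmult_1_r 3) at 2. apply Rmult_le_compat_l; [lra|].
rewrite <- Rinv_1. apply Rinv_le_contravar; lra.
Qed.

Lemma Cmod_sin_coef (k : nat) : (Cmod (sin_coef k) <= / INR (fact k))%R.
Proof.
assert (F1 : (0 < INR (fact k))%R) by apply INR_fact_lt_0.
unfold sin_coef. rewrite !Cmod_div by
  first [apply INR_fact_ne_0|apply Cmult_neq_0; [apply C2_ne_0|apply Ci_ne_0]].
rewrite Cmod_mult, Cmod_Ci, !Cmod_R, !Rabs_pos_eq by lra.
pose proof (Cmod_triangle_minus (Ci ^ k) ((- Ci) ^ k)) as T.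
rewrite !Cmod_pow, Cmod_opp, Cmod_Ci, !pow1 in T.
unfold Rdiv. rewrite <- (Rmult_1_l (/ INR (fact k))) at 2.
apply Rmult_le_compat_r; [left; now apply Rinv_0_lt_compat|]. lra.
Qed.

Lemma sin_coef_0 : sin_coef 0 = 0.
Proof. unfold sin_coef. simpl. field. apply Ci_ne_0. Qed.

Lemma sin_coef_1 : sin_coef 1 = 1.
Proof. unfold sin_coef. simpl. field. apply Ci_ne_0. Qed.

Lemma pow2_le_fact (n : nat) : (2 ^ n <= INR (fact (S n)))%R.
Proof.
induction n as [|n IH]; [simpl; lra|].
rewrite fact_simpl, mult_INR. change (2 ^ S n)%R with (2 * 2 ^ n)%R.
assert (0 < 2 ^ n)%R by (apply pow_lt; lra).
apply Rmult_le_compat; try lra. rewrite !S_INR. pose proof (pos_INR n). lra.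
Qed.

(** Division by [1 - z] turns the coefficients of [sin] into their partial sums. *)
Definition xi_coef (n : nat) : C := Csum sin_coef (S n).

(** The value 2 is what the recursion tolerates: it cancels the 2 in [2 u G'] and keeps
    [extremal_coef] bounded by 1. *)
Lemma Cmod_xi_coef (n : nat) : (Cmod (xi_coef n) <= 2)%R.
Proof.
(* Strengthened for the induction: [1/k! <= 2^(1-k)] is summed as a geometric series. *)
assert (H : (Cmod (xi_coef n) <= 2 - 2 * (/ 2) ^ n)%R).
{ unfold xi_coef. induction n as [|n IH].
  - simpl. rewrite sin_coef_0, Cplus_0_l, Cmod_0. lra.
  - rewrite Csum_last. eapply Rle_trans; [apply Cmod_triangle|].
    assert (Cmod (sin_coef (S n)) <= (/ 2) ^ n)%R.
    { eapply Rle_trans; [apply Cmod_sin_coef|]. rewrite pow_inv.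
      apply Rinv_le_contravar; [apply pow_lt; lra|apply pow2_le_fact]. }
    simpl pow. lra. }
assert (0 < (/ 2) ^ n)%R by (apply pow_lt; lra). lra.
Qed.

Lemma conv_D_xi_coef : conv_D xi_coef.
Proof. exact (conv_D_bounded _ _ Cmod_xi_coef). Qed.

Lemma xi_coef_0 : xi_coef 0 = 0.
Proof. unfold xi_coef. simpl. rewrite sin_coef_0. ring. Qed.

(** Since [xi_coef (S n) = xi_coef n + sin_coef (S n)], multiplying the series by [1 - u] telescopes
    to the sine. *)
Lemma xi_series (u : C) : inD u -> xi u = 1 + Cpsum xi_coef u.
Proof.
intros Hu.
assert (Hs : conv_D sin_coef) by (intros z Hz; eexists; now apply Csin_series).
assert (E1 := Cpsum_tail xi_coef u conv_D_xi_coef Hu).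
assert (E2 := Cpsum_tail sin_coef u Hs Hu).
rewrite (Cpsum_eq sin_coef u (Csin u)) in E2 by now apply Csin_series.
rewrite sin_coef_0 in E2. rewrite xi_coef_0 in E1.
assert (E3 : Cpsum (fun n => xi_coef (S n)) u = 1 * Cpsum xi_coef u + 1 * Cpsum (fun n => sin_coef (S n)) u).
{ apply Cpsum_eq. apply (Cps_scal_plus xi_coef (fun n => sin_coef (S n))).
  - intros n. unfold xi_coef. rewrite Csum_last. ring.
  - apply Cpsum_spec; auto. apply conv_D_xi_coef.
  - apply Cpsum_spec; auto. now apply conv_D_tail. }
assert (N : 1 - u <> 0) by now apply inD_one_minus_ne_0.
unfold xi. f_equal.
assert (E4 : (1 - u) * Cpsum xi_coef u = Csin u).
{ rewrite E2. transitivity (Cpsum xi_coef u - u * Cpsum xi_coef u); [ring|].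
  rewrite E1 at 1. rewrite E3. ring. }
rewrite <- E4. field. exact N.
Qed.

(** With [f(z) = z G(z^2)], the extremal equation [z f'/f = xi(z^2)] becomes
    [2 u G'(u) = (xi(u) - 1) G(u)]; [extremal_coef] are the coefficients of [G]. *)
Fixpoint extremal_prefix (n : nat) : nat -> C :=
  match n with
  | O => fun _ => 1
  | S m => fun k =>
      if Nat.eq_dec k (S m)
      then Cconv (fun j => xi_coef (S j)) (extremal_prefix m) m / (2 * INR (S m))
      else extremal_prefix m k
  end.

Definition extremal_coef (n : nat) : C := extremal_prefix n n.

(** Each coefficient depends on all earlier ones, so the recursion builds tables: stage [S m]
    changes only entry [S m], and the diagonal agrees with every later stage. *)
Lemma extremal_prefix_eq (n k : nat) : (k <= n)%nat -> extremal_prefix n k = extremal_coef k.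
Proof.
induction n as [|n IH]; intros H.
- now replace k with O by lia.
- simpl. destruct (Nat.eq_dec k (S n)) as [->|Hne].
  + unfold extremal_coef. simpl. destruct (Nat.eq_dec n n); [reflexivity|easy].
  + apply IH. lia.
Qed.

Lemma extremal_coef_S (n : nat) :
  extremal_coef (S n) = Cconv (fun j => xi_coef (S j)) extremal_coef n / (2 * INR (S n)).
Proof.
unfold extremal_coef at 1. cbn [extremal_prefix]. destruct (Nat.eq_dec (S n) (S n)); [|easy].
f_equal. unfold Cconv. apply Csum_ext. intros k Hk. f_equal. apply extremal_prefix_eq. lia.
Qed.

Lemma INR_S_ne_0 (n : nat) : RtoC (INR (S n)) <> 0.
Proof. intros E. apply RtoC_inj in E. revert E. apply not_0_INR. lia. Qed.

Lemma Cmod_extremal_coef (n : nat) : (Cmod (extremal_coef n) <= 1)%R.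
Proof.
induction n as [n IH] using (well_founded_induction Wf_nat.lt_wf).
destruct n as [|n].
- unfold extremal_coef. simpl. rewrite Cmod_1. lra.
- rewrite extremal_coef_S.
  rewrite Cmod_div by (apply Cmult_neq_0; [apply C2_ne_0|apply INR_S_ne_0]).
  rewrite Cmod_mult, !Cmod_R, !Rabs_pos_eq by (try lra; apply pos_INR).
  assert (P : (0 < INR (S n))%R) by (apply lt_0_INR; lia).
  assert (H : (Cmod (Cconv (fun j => xi_coef (S j)) extremal_coef n) <= INR (S n) * 2)%R).
  { apply Cmod_Csum_le. intros k Hk. rewrite Cmod_mult.
    pose proof (Cmod_xi_coef (S k)). specialize (IH (n - k)%nat ltac:(lia)).
    pose proof (Cmod_ge_0 (xi_coef (S k))). pose proof (Cmod_ge_0 (extremal_coef (n - k))). nra. }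
  apply Rmult_le_reg_r with (2 * INR (S n))%R; [lra|].
  unfold Rdiv. rewrite Rmult_assoc, Rinv_l by lra. lra.
Qed.

Lemma conv_D_extremal_coef : conv_D extremal_coef.
Proof. exact (conv_D_bounded _ _ Cmod_extremal_coef). Qed.

(** The recursion [extremal_coef_S] is this equation coefficient by coefficient. A common factor [u]
    has been removed, as [xi_coef 0 = 0]. *)
Lemma extremal_ode (u : C) : inD u ->
  2 * Cpsum (Cps_derive extremal_coef) u = Cpsum (fun n => xi_coef (S n)) u * Cpsum extremal_coef u.
Proof.
intros Hu.
assert (Hg := conv_D_extremal_coef). assert (Ht := conv_D_tail _ conv_D_xi_coef).
assert (M := Cpsum_mult _ _ u Ht Hg Hu).
apply (Cps_unique (Cconv (fun n => xi_coef (S n)) extremal_coef) u); auto.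
replace (2 * Cpsum (Cps_derive extremal_coef) u) with
  (2 * Cpsum (Cps_derive extremal_coef) u + 0 * Cpsum extremal_coef u) by ring.
eapply Cps_scal_plus; [|apply Cpsum_spec; auto; now apply conv_D_derive|now apply Cpsum_spec].
intros n. unfold Cps_derive. rewrite extremal_coef_S. field. apply INR_S_ne_0.
Qed.

(** [G] times [exp] of minus a primitive of [G'/G] has zero derivative. *)
Lemma extremal_ne_0 (u : C) : inD u -> Cpsum extremal_coef u <> 0.
Proof.
intros Hu E0.
(* The termwise primitive of the series [T] of [xi_coef (S n)]; by [extremal_ode], [2 G' = T G],
   hence the factor [- / 2] in [H]. *)
pose (th := fun n => match n with O => RtoC 0 | S m => xi_coef (S m) / INR (S m) end).
assert (Hth : conv_D th).
{ apply conv_D_bounded with 2%R. intros [|m]; unfold th; [rewrite Cmod_0; lra|].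
  rewrite Cmod_div by apply INR_S_ne_0. rewrite Cmod_R, Rabs_pos_eq by apply pos_INR.
  pose proof (Cmod_xi_coef (S m)). pose proof (Cmod_ge_0 (xi_coef (S m))).
  assert (P : (1 <= INR (S m))%R) by (apply (le_INR 1); lia).
  apply Rmult_le_reg_r with (INR (S m)); [lra|].
  unfold Rdiv. rewrite Rmult_assoc, Rinv_l by lra. nra. }
assert (Eth : forall z, inD z -> Cpsum (Cps_derive th) z = Cpsum (fun n => xi_coef (S n)) z).
{ intros z Hz. apply Cpsum_eq, Cps_Cser.
  apply (Cser_ext (fun n => xi_coef (S n) * z ^ n)).
  - intros n. unfold Cps_derive, th. field. apply INR_S_ne_0.
  - apply Cps_Cser, Cpsum_spec; auto. apply conv_D_tail, conv_D_xi_coef. }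
pose (H := fun z => Cpsum extremal_coef z * Cexp (- / 2 * Cpsum th z)).
(* The mean value bound with constant 0 makes [H] constant, and [H 0] is a value of [Cexp]. *)
assert (B := cderiv_bound_pow H (fun _ => 0) 0 1 0 0).
assert (HB : (Cmod (H (0 + u)%C - H 0) <= 0 * Cmod u ^ 1 / INR 1)%R).
{ apply B; auto.
  - intros h Hh. rewrite Cplus_0_l.
    assert (Hg := Cpsum_cderiv _ h conv_D_extremal_coef Hh).
    assert (Ht := Cpsum_cderiv _ h Hth Hh). rewrite Eth in Ht by exact Hh.
    assert (Hode := extremal_ode h Hh).
    eapply cderiv_val.
    + apply cderiv_mult; [exact Hg|]. apply (cderiv_comp Cexp (fun z => - / 2 * Cpsum th z)).
      * apply cderiv_Cexp.
      * apply cderiv_scal. exact Ht.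
    + cbv beta.
      transitivity (/ 2 * Cexp (- / 2 * Cpsum th h) * (2 * Cpsum (Cps_derive extremal_coef) h
         - Cpsum (fun n => xi_coef (S n)) h * Cpsum extremal_coef h)); [field|].
      rewrite Hode. ring.
  - intros h Hh. rewrite Cmod_0. simpl. lra. }
assert (HH : H u = H 0).
{ apply Cminus_eq_0, Cmod_eq_0, Rle_antisym; [|apply Cmod_ge_0].
  rewrite Cplus_0_l in HB. replace (0 * Cmod u ^ 1 / INR 1)%R with 0%R in HB by (simpl; field). exact HB. }
unfold H in HH. rewrite E0, Cmult_0_l in HH.
rewrite (Cpsum_tail extremal_coef 0) in HH by (auto using inD_0, conv_D_extremal_coef).
revert HH. rewrite Cmult_0_l, Cplus_0_r. unfold extremal_coef at 1. simpl extremal_prefix.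
rewrite Cmult_1_l. intros HH. symmetry in HH. revert HH. apply Cexp_ne_0.
Qed.

(** * The odd function z G(z^2) *)

Definition extremal_fun (z : C) : C := z * Cpsum extremal_coef (z ^ 2).

Definition extremal_fun_coef (n : nat) : C :=
  if Nat.odd n then extremal_coef (Nat.div2 n) else 0.

Lemma Csum_extremal_fun (z : C) (n : nat) :
  Csum (fun k => extremal_fun_coef k * z ^ k) (2 * n)
    = z * Csum (fun k => extremal_coef k * (z ^ 2) ^ k) n.
Proof.
induction n as [|n IH]; [simpl; ring|].
replace (2 * S n)%nat with (S (S (2 * n))) by lia. rewrite !Csum_last, IH.
unfold extremal_fun_coef at 1 2.
replace (Nat.odd (2 * n)) with false by (now rewrite Nat.odd_mul).
replace (Nat.odd (S (2 * n))) with true by (rewrite Nat.odd_succ; symmetry; apply Nat.even_spec; now exists n).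
replace (Nat.div2 (S (2 * n))) with n by (symmetry; apply Nat.div2_succ_double).
rewrite (Cpow_S z (2 * n)), (Cpow_mult_r z 2 n). ring.
Qed.

Lemma inD_sqr (z : C) : inD z -> inD (z ^ 2).
Proof. unfold inD. rewrite Cmod_pow. pose proof (Cmod_ge_0 z). intros. simpl. nra. Qed.

Lemma extremal_fun_in_A : in_A extremal_fun extremal_fun_coef.
Proof.
split; [reflexivity|]. split; [reflexivity|].
intros z Hz. apply Cps_Cser. intros e He.
assert (S1 := Cpsum_spec _ _ conv_D_extremal_coef (inD_sqr z Hz)). apply Cps_Cser in S1.
destruct (Cser_scal z _ _ S1 e He) as (N & HN). exists (2 * N)%nat. intros n Hn.
(* For odd [n] the last index [n - 1] is even and has coefficient 0, so rounding [n] down to an even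
   number changes nothing. *)
assert (E : Csum (fun k => extremal_fun_coef k * z ^ k) n
   = Csum (fun k => z * (extremal_coef k * (z ^ 2) ^ k)) (Nat.div2 n)).
{ rewrite Csum_scal, <- Csum_extremal_fun.
  destruct (Nat.Even_or_Odd n) as [Hev|Hodd].
  - f_equal. destruct Hev as [m ->]. now rewrite Nat.div2_double.
  - destruct Hodd as [m ->]. replace (2 * m + 1)%nat with (S (2 * m)) by lia.
    rewrite Nat.div2_succ_double, Csum_last. unfold extremal_fun_coef at 2.
    replace (Nat.odd (2 * m)) with false by (now rewrite Nat.odd_mul). ring. }
rewrite E. apply HN.
destruct (Nat.Even_or_Odd n) as [[m ->]|[m ->]].
- rewrite Nat.div2_double. lia.
- replace (2 * m + 1)%nat with (S (2 * m)) in * by lia. rewrite Nat.div2_succ_double. lia.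
Qed.

Lemma extremal_fun_in_S_xi : in_S_xi extremal_fun extremal_fun_coef.
Proof.
split; [apply extremal_fun_in_A|].
assert (Hsq : forall z, cderiv (fun x => x ^ 2) z (2 * z)).
{ intros z. eapply cderiv_val; [apply cderiv_pow, cderiv_id|].
  cbv beta. replace (RtoC (INR 2)) with (RtoC 2) by (f_equal; simpl; ring). simpl. ring. }
exists (fun z => z ^ 2). split; [|split; [simpl; ring|split; [apply inD_sqr|]]].
- intros z _. exists (2 * z). apply cderiv_is_derive. apply Hsq.
- intros z Hz Hnz. assert (Hz2 := inD_sqr z Hz). assert (Hg := extremal_ne_0 _ Hz2).
  split; [now apply Cmult_neq_0|].
  eexists. split.
  + apply cderiv_is_derive. apply (cderiv_mult (fun z => z)); [apply cderiv_id|].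
    apply (cderiv_comp (Cpsum extremal_coef) (fun z => z ^ 2)); [|apply Hsq].
    apply Cpsum_cderiv; auto. apply conv_D_extremal_coef.
  + rewrite xi_series by auto. unfold extremal_fun.
    rewrite (Cpsum_tail xi_coef _ conv_D_xi_coef Hz2), xi_coef_0.
    assert (Hode := extremal_ode _ Hz2).
    set (G := Cpsum extremal_coef (z ^ 2)) in *. set (T := Cpsum (fun n => xi_coef (S n)) (z ^ 2)) in *.
    set (G' := Cpsum (Cps_derive extremal_coef) (z ^ 2)) in *.
    (* By the product and chain rules [z f'/f = 1 + 2 z^2 G'/G], and [extremal_ode] replaces [2 G']
       by [T G]. *)
    transitivity (1 + z ^ 2 * (2 * G') / G); [simpl; field; auto|].
    rewrite Hode. field. auto.
Qed.

Lemma extremal_H22 : Cmod (H22 extremal_fun_coef) = (/ 4)%R.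
Proof.
(* Even coefficients vanish and [a3 = xi_coef 1 / 2 = 1/2], so only [- a3^2] remains. *)
replace (H22 extremal_fun_coef) with (- RtoC (/ 4)).
- rewrite Cmod_opp, Cmod_R, Rabs_pos_eq; lra.
- unfold H22, extremal_fun_coef. simpl Nat.odd. cbn [Nat.div2].
  rewrite extremal_coef_S. unfold Cconv, xi_coef, extremal_coef. simpl.
  rewrite sin_coef_0, sin_coef_1. rewrite RtoC_inv by lra. field.
Qed.

Theorem theorem3p5 :
  (forall (f : C -> C) (a : nat -> C), in_S_xi f a -> (Cmod (H22 a) <= / 4)%R) /\
  (exists (f : C -> C) (a : nat -> C), in_S_xi f a /\ Cmod (H22 a) = (/ 4)%R).
Proof.
split; [exact hankel_bound|].
exists extremal_fun, extremal_fun_coef. split; [apply extremal_fun_in_S_xi|apply extremal_H22].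
Qed.
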